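(* There is a $4$-factor approximation algorithm for the Single Multiple Full Cover (SMFC) problem.
   Context: SMFC problem. The input is a range of timeslots $[1,T]$ with an integral demand $d_t$ at each timeslot $t$, and a set of resources. Each resource $i$ has an interval $[s(i),e(i)]\subseteq[1,T]$, a capacity $w(i)$ and a cost $c(i)$, and is of one of two types: S-type or M-type. A resource is active at $t$ if $t$ lies in its interval. A valid solution is a multiset of resources containing at most one copy of each S-type resource (arbitrarily many copies of M-type resources are allowed). A feasible solution is a valid solution $S$ such that for every timeslot $t$, the total capacity (with multiplicity) of the resources of $S$ active at $t$ is at least $d_t$. The cost is the sum of costs with multiplicity; the goal is to find a feasible solution of minimum cost. An approximation algorithm runs in polynomial time and outputs a feasible solution of cost at most the stated factor times the optimum. *)

(* Defs.v *)
From HB Require Import structures.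
From mathcomp Require Import all_boot all_order all_algebra.

Set Implicit Arguments.
Unset Strict Implicit.
Unset Printing Implicit Defensive.

Import Order.TTheory GRing.Theory Num.Theory.
Local Open Scope ring_scope.

Inductive rtype := SType | MType.

(* Capacities and costs are nonnegative rationals, so that instances are finite
   objects (see [wf_instance] for nonnegativity). *)
Record resource := Resource {
  rstart : nat;
  rend : nat;
  capacity : rat;
  cost : rat;
  kind : rtype
}.

(* Timeslots are numbered 1, ..., horizon; [demand] is irrelevant elsewhere. *)
Record instance := Instance {
  horizon : nat;
  demand : nat -> nat;
  nres : nat;
  res : 'I_nres -> resource
}.

Definition wf_resource (T : nat) (r : resource) : bool :=
  [&& (1 <= rstart r)%N, (rstart r <= rend r)%N, (rend r <= T)%N,
      0 <= capacity r & 0 <= cost r].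

Definition wf_instance (I : instance) : Prop :=
  forall i : 'I_(nres I), wf_resource (horizon I) (res i).

Definition active (r : resource) (t : nat) : bool :=
  (rstart r <= t <= rend r)%N.

(* A multiset of resources, given by its multiplicity function. *)
Definition multiset (I : instance) := 'I_(nres I) -> nat.

Definition valid (I : instance) (S : multiset I) : Prop :=
  forall i, kind (res i) = SType -> (S i <= 1)%N.

Definition capacity_at (I : instance) (S : multiset I) (t : nat) : rat :=
  \sum_(i < nres I | active (res i) t) capacity (res i) *+ S i.

Definition feasible (I : instance) (S : multiset I) : Prop :=
  valid S /\
  forall t : nat, (1 <= t <= horizon I)%N -> (demand I t)%:R <= capacity_at S t.

Definition total_cost (I : instance) (S : multiset I) : rat :=
  \sum_(i < nres I) cost (res i) *+ S i.

Definition is_optimum (I : instance) (v : rat) : Prop :=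
  (exists2 S : multiset I, feasible S & total_cost S = v) /\
  (forall S : multiset I, feasible S -> v <= total_cost S).

(* A random access machine with logarithmic cost. The memory is a two-sided infinite array of integers; control flow is
   structured. Every operation is charged the bit lengths of all the addresses
   and values it handles, so running time is polynomially related to that of a
   Turing machine, multiplication and division included. *)

Definition memory := int -> int.

Definition update (m : memory) (a v : int) : memory :=
  fun x => if x == a then v else m x.

(* The number of binary digits of `|z|, with 1 for zero. *)
Definition bits (z : int) : nat := (trunc_log 2 `|z|%N).+1.

Inductive binop := OpAdd | OpSub | OpMul | OpDiv.

Definition binop_sem (o : binop) : int -> int -> int :=
  match o with
  | OpAdd => fun x y => x + y
  | OpSub => fun x y => x - y
  | OpMul => fun x y => x * y
  | OpDiv => fun x y => (x %/ y)%Z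
  end.

Inductive expr :=
  | Const of int
  | Read of expr (* content of the cell whose address is the given value *)
  | Op of binop & expr & expr.

Fixpoint eval (m : memory) (e : expr) : int :=
  match e with
  | Const z => z
  | Read a => m (eval m a)
  | Op o e1 e2 => binop_sem o (eval m e1) (eval m e2)
  end.

Fixpoint eval_time (m : memory) (e : expr) : nat :=
  match e with
  | Const z => bits z
  | Read a => eval_time m a + bits (eval m a) + bits (m (eval m a))
  | Op o e1 e2 =>
      eval_time m e1 + eval_time m e2 + bits (eval m e1) + bits (eval m e2)
  end%N.

Inductive program :=
  | Skip
  | Store of expr & expr (* address, value *)
  | Seq of program & program
  | If of expr & program & program
  | While of expr & program.

(* [exec c m m' t]: started on memory [m], [c] halts on memory [m'] after time
   [t]. A test succeeds when its value is positive. *)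
Inductive exec : program -> memory -> memory -> nat -> Prop :=
  | ExecSkip m :
      exec Skip m m 1
  | ExecStore a e m :
      exec (Store a e) m (update m (eval m a) (eval m e))
        (eval_time m a + eval_time m e
           + bits (eval m a) + bits (eval m e)).+1%N
  | ExecSeq c1 c2 m1 m2 m3 t1 t2 :
      exec c1 m1 m2 t1 -> exec c2 m2 m3 t2 ->
      exec (Seq c1 c2) m1 m3 (t1 + t2).+1%N
  | ExecIfTrue e c1 c2 m m' t :
      0 < eval m e -> exec c1 m m' t ->
      exec (If e c1 c2) m m' (eval_time m e + t).+1%N
  | ExecIfFalse e c1 c2 m m' t :
      eval m e <= 0 -> exec c2 m m' t ->
      exec (If e c1 c2) m m' (eval_time m e + t).+1%N
  | ExecWhileTrue e c m1 m2 m3 t1 t2 :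
      0 < eval m1 e -> exec c m1 m2 t1 -> exec (While e c) m2 m3 t2 ->
      exec (While e c) m1 m3 (eval_time m1 e + t1 + t2).+1%N
  | ExecWhileFalse e c m :
      eval m e <= 0 ->
      exec (While e c) m m (eval_time m e).+1.

Definition encode_kind (k : rtype) : int := if k is SType then 0 else 1.

Definition encode_resource (r : resource) : seq int :=
  [:: (rstart r)%:Z; (rend r)%:Z;
      numq (capacity r); denq (capacity r);
      numq (cost r); denq (cost r);
      encode_kind (kind r)].

Definition encode (I : instance) : seq int :=
  (horizon I)%:Z :: (nres I)%:Z ::
  [seq (demand I t)%:Z | t <- iota 1 (horizon I)] ++
  flatten [seq encode_resource (res i) | i <- enum 'I_(nres I)].

Definition input_size (I : instance) : nat := (\sum_(z <- encode I) bits z)%N.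

(* The input occupies cells 0, 1, 2, ...; all other cells, in particular those
   with negative addresses, start at 0. *)
Definition input_memory (I : instance) : memory :=
  fun a => if a is Posz k then nth 0 (encode I) k else 0.

(* The output is the list of multiplicities, in binary, found in cells
   0, ..., nres I - 1. *)
Definition outputs (I : instance) (m : memory) (S : multiset I) : Prop :=
  forall i : 'I_(nres I), m (val i)%:Z = (S i)%:Z.

Definition runs_in_polynomial_time (c : program) : Prop :=
  exists p : {poly nat}, forall I : instance, wf_instance I ->
    exists (m : memory) (t : nat),
      exec c (input_memory I) m t /\ (t <= p.[input_size I])%N.

(* The guarantee on the output concerns the instances that have a feasible
   solution; the polynomial time bound concerns all instances. *)
Definition approximation_algorithm (alpha : rat) (c : program) : Prop :=
  runs_in_polynomial_time c /\
  forall I : instance, wf_instance I ->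
    (exists S : multiset I, feasible S) ->
    exists (m : memory) (t : nat) (S : multiset I) (opt : rat),
      [/\ exec c (input_memory I) m t, outputs m S, feasible S,
          is_optimum I opt & total_cost S <= alpha * opt].

(* Main.v *)
Require Import Defs.
From HB Require Import structures.
From mathcomp Require Import all_boot all_order all_algebra.
From mathcomp Require Import zify ring lra.
From Stdlib Require Import Classical_Prop.

(* Scale all numbers to integers and run a local-ratio algorithm. In each round,
   let [t] be the slot of largest deficit [d]; charge every unselected
   resource active at [t] in proportion to [min (capacity, d)] until the
   residual cost of one of them vanishes, and select it: one copy if it is of
   S-type, enough copies to remove the deficit on its whole interval if it is of
   M-type. Then go through the selected resources in reverse order and drop as
   many copies of each as feasibility allows. With respect to the charge of one
   round, any feasible solution costs at least [d] by the knapsack cover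
   inequality, while the remaining copies selected from that round on cost at
   most [4 d] by minimality. Residual costs are kept as integers up to a common
   factor, so each round lengthens them by at most linearly many bits. *)

Set Implicit Arguments.
Unset Strict Implicit.
Unset Printing Implicit Defensive.

Import Order.TTheory GRing.Theory Num.Theory.
Local Open Scope ring_scope.

(** * Time bounds and weakest preconditions for programs *)

(** The factor 4 is 2 times 2. The charged copies are split by the side of [t] on which they are
    indispensable. On one side, setting aside one copy that is indispensable at the slot nearest to
    [t] leaves capacity below [d], and the copy set aside is itself charged at most [d] because of
    the truncation [min (capacity, d)]. The lower bound survives the truncation, since a single
    resource of capacity at least [d] already pays [d]. Halting in polynomial time is also required
    on instances without a feasible solution. Hence both passes make exactly one round per resource
    whatever the deficits are, a round with nothing to charge changes nothing, and the bounds on bit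
    lengths are proved without feasibility. A solution [y] to compare with enters only in the proofs
    of coverage and of the cost ratio. That many rounds suffice because every effective round
    selects a resource that had no copy yet. *)

Fixpoint esize (e : expr) : nat :=
  match e with
  | Const z => bits z
  | Read _ => 1
  | Op _ e1 e2 => esize e1 + esize e2
  end.

Fixpoint eval_cost (R : nzSemiRingType) (B : R) (e : expr) : R :=
  match e with
  | Const z => (bits z)%:R
  | Read a => eval_cost B a + (esize a)%:R * B + B
  | Op _ e1 e2 =>
      eval_cost B e1 + eval_cost B e2 + (esize e1 + esize e2)%:R * B
  end.

(* Time bound read off the syntax when every loop is iterated at most [L] times
   and memory contents have at most [B] bits. The semiring is arbitrary so that
   [L] and [B] can be polynomials in the input size. *)
Fixpoint time_bound (R : nzSemiRingType) (L B : R) (c : program) : R :=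
  match c with
  | Skip => 1
  | Store a e =>
      eval_cost B a + eval_cost B e + (esize a + esize e)%:R * B + 1
  | Seq c1 c2 => time_bound L B c1 + time_bound L B c2 + 1
  | If e c1 c2 => eval_cost B e + time_bound L B c1 + time_bound L B c2 + 1
  | While e c => (L + 1) * (eval_cost B e + time_bound L B c + 1)
  end.

Lemma horner_eval_cost (B : {poly nat}) e s :
  (eval_cost B e).[s] = eval_cost B.[s] e.
Proof.
elim: e => [z|e IH|o e1 IH1 e2 IH2] /=; rewrite ?hornerD ?hornerM ?hornerMn.
- by rewrite hornerC.
- by rewrite IH hornerC.
- by rewrite IH1 IH2 hornerC.
Qed.

Lemma horner_time_bound (L B : {poly nat}) c s :
  (time_bound L B c).[s] = time_bound L.[s] B.[s] c.
Proof.
elim: c => [|a e|c1 IH1 c2 IH2|e c1 IH1 c2 IH2|e c IH] /=;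
  rewrite ?hornerE ?hornerMn ?horner_eval_cost ?IH1 ?IH2 ?IH ?hornerC //.
Qed.

Definition bounded (B : nat) (m : memory) := forall a, (`|m a| < 2 ^ B)%N.

Lemma bits_leq z k : (0 < k)%N -> (`|z| < 2 ^ k)%N -> (bits z <= k)%N.
Proof.
rewrite /bits => k0 zk; case: (posnP `|z|%N) => [->|z0].
  by rewrite trunc_log0.
by rewrite -(@ltn_exp2l 2) //; apply: leq_ltn_trans zk; apply: trunc_logP.
Qed.

Lemma ltn_bits z : (`|z| < 2 ^ bits z)%N.
Proof. exact: trunc_log_ltn. Qed.

Lemma esize_gt0 e : (0 < esize e)%N.
Proof. by elim: e => //= _ e1 IH1 e2 IH2; rewrite addn_gt0 IH1. Qed.

(** For positive [p] and [q], [2 ^ p + 2 ^ q <= 2 ^ p * 2 ^ q], so sums obey the same additive rule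
    for lengths as products; a quotient never exceeds its numerator in absolute value, even for
    divisor 0. *)
Lemma binop_bound o (x y : int) p q : (0 < p)%N -> (0 < q)%N ->
  (`|x| < 2 ^ p)%N -> (`|y| < 2 ^ q)%N -> (`|binop_sem o x y| < 2 ^ (p + q))%N.
Proof.
move=> p0 q0 xp yq; rewrite expnD.
have [p2 q2] : (2 <= 2 ^ p /\ 2 <= 2 ^ q)%N.
  by rewrite -{1 3}(expn1 2) !leq_exp2l.
case: o => /=.
- have : (`|(x + y)%R| <= `|x| + `|y|)%N by lia.
  by move=> h; apply: leq_ltn_trans h _; nia.
- have : (`|x - y| <= `|x| + `|y|)%N by lia.
  by move=> h; apply: leq_ltn_trans h _; nia.
- by rewrite abszM; apply: ltn_mul.
- apply: leq_ltn_trans (lez_div _ _) _.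
  by apply: leq_trans xp _; rewrite leq_pmulr // expn_gt0.
Qed.

Section Bounded.

Variables (L B : nat).
Hypothesis B0 : (0 < B)%N.

Section Eval.
Variable m : memory.
Hypothesis mB : bounded B m.

(** Lengths of operands add under every operation, so [esize] counts the blocks of [B] bits that a
    value can fill. Only stored values have to fit in one block. *)
Lemma eval_bound e : (`|eval m e| < 2 ^ (esize e * B))%N.
Proof.
elim: e => [z|e IH|o e1 IH1 e2 IH2].
- by apply: leq_trans (ltn_bits z) _; rewrite leq_exp2l // leq_pmulr.
- by rewrite mul1n; apply: mB.
- by rewrite /= mulnDl; apply: binop_bound; rewrite // muln_gt0 esize_gt0.
Qed.

Lemma bits_eval e : (bits (eval m e) <= esize e * B)%N.
Proof. by apply: bits_leq (eval_bound e); rewrite muln_gt0 esize_gt0. Qed.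

Lemma eval_time_cost e : (eval_time m e <= eval_cost B e)%N.
Proof.
elim: e => [z|e IH|o e1 IH1 e2 IH2] //=.
- by rewrite natn.
- rewrite natn !leq_add // ?bits_eval //.
  by apply: bits_leq => //; apply: mB.
- have := bits_eval e1; have := bits_eval e2; rewrite natn.
  rewrite ?mulnDl; lia.
Qed.

End Eval.

(** Total correctness with the time bound and the preservation of [B]-bit contents built in:
    postconditions need no clock, and what recurs as an obligation is that each stored value
    fits. *)
Definition wp (c : program) (m : memory) (Q : memory -> Prop) : Prop :=
  bounded B m -> exists m' t,
    [/\ exec c m m' t, (t <= time_bound L B c)%N, bounded B m' & Q m'].

Lemma wp_weaken c m (Q Q' : memory -> Prop) :
  wp c m Q -> (forall m', bounded B m' -> Q m' -> Q' m') -> wp c m Q'.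
Proof.
move=> h QQ' /h[m' [t [e tc b q]]]; exists m', t; split => //; exact: QQ'.
Qed.

Lemma wp_skip m (Q : memory -> Prop) : Q m -> wp Skip m Q.
Proof. by move=> q b; exists m, 1%N; split => //; constructor. Qed.

Lemma bounded_update m a v :
  bounded B m -> (`|v| < 2 ^ B)%N -> bounded B (update m a v).
Proof. by move=> mB vB x; rewrite /update; case: ifP. Qed.

Lemma wp_store a e m (Q : memory -> Prop) :
  (bounded B m -> `|eval m e| < 2 ^ B)%N ->
  (bounded B m -> Q (update m (eval m a) (eval m e))) -> wp (Store a e) m Q.
Proof.
move=> vB q mB; exists (update m (eval m a) (eval m e)).
exists (eval_time m a + eval_time m e
        + bits (eval m a) + bits (eval m e)).+1%N.
split; [by constructor | | by apply: bounded_update; auto | exact: q].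
have := eval_time_cost mB a; have := eval_time_cost mB e.
have := bits_eval mB a; have := bits_eval mB e; rewrite /= natn.
rewrite ?mulnDl; lia.
Qed.

Lemma wp_seq c1 c2 m (Q : memory -> Prop) :
  wp c1 m (fun m' => wp c2 m' Q) -> wp (Seq c1 c2) m Q.
Proof.
move=> h /h[m1 [t1 [e1 tc1 b1 /(_ b1)[m2 [t2 [e2 tc2 b2 q]]]]]].
exists m2, (t1 + t2).+1; split => //; first exact: ExecSeq e1 e2.
by rewrite /= -(addn1 (t1 + t2)); apply: leq_add => //; apply: leq_add.
Qed.

Lemma wp_if e c1 c2 m (Q : memory -> Prop) :
  (0 < eval m e -> wp c1 m Q) -> (eval m e <= 0 -> wp c2 m Q) ->
  wp (If e c1 c2) m Q.
Proof.
move=> h1 h2 mB; have tB := eval_time_cost mB e.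
have [e0|e0] := ltrP 0 (eval m e).
- have [m' [t [x tc b q]]] := h1 e0 mB; exists m', (eval_time m e + t).+1.
  split => //=; first exact: ExecIfTrue.
  lia.
- have [m' [t [x tc b q]]] := h2 e0 mB; exists m', (eval_time m e + t).+1.
  split => //=; first exact: ExecIfFalse.
  lia.
Qed.

Lemma wp_while e c (N : nat) (Inv : nat -> memory -> Prop) m
    (Q : memory -> Prop) :
  (N <= L)%N -> Inv 0%N m ->
  (forall k m, (k < N)%N -> bounded B m -> Inv k m ->
     0 < eval m e /\ wp c m (Inv k.+1)) ->
  (forall m, bounded B m -> Inv N m -> eval m e <= 0 /\ Q m) ->
  wp (While e c) m Q.
Proof.
move=> NL inv step stop mB.
suff gen d : forall k m, bounded B m -> Inv k m -> (d + k = N)%N ->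
    exists m' t,
    [/\ exec (While e c) m m' t,
        (t <= d.+1 * (eval_cost B e + time_bound L B c + 1))%N,
        bounded B m' & Q m'].
  have [m' [t [x tc b q]]] := gen N 0%N m mB inv (addn0 N).
  exists m', t; split => //; apply: leq_trans tc _; rewrite /=.
  by apply: leq_mul => //; lia.
elim: d {m inv mB} => [|d IH] k m mB inv dN.
  rewrite add0n in dN; rewrite dN in inv.
  have [e0 q] := stop m mB inv; have tB := eval_time_cost mB e.
  exists m, (eval_time m e).+1; split => //; first exact: ExecWhileFalse.
  lia.
have kN : (k < N)%N by lia.
have [e0 /(_ mB)[m1 [t1 [x1 tc1 b1 inv1]]]] := step k m kN mB inv.
have dN' : (d + k.+1 = N)%N by lia.
have [m2 [t2 [x2 tc2 b2 q]]] := IH k.+1 m1 b1 inv1 dN'.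
exists m2, (eval_time m e + t1 + t2).+1.
have tB := eval_time_cost mB e.
split => //; first exact: ExecWhileTrue x1 x2.
rewrite mulSn; move: tc2; set u := (_ * _)%N => tc2.
lia.
Qed.

End Bounded.

(* Array [k], for [k < 24], occupies the cells congruent to [k] modulo 24; its
   entries of nonnegative index lie at negative addresses. A scalar variable is
   entry 0 of an array. *)
Definition loc (k : nat) (z : int) : int := k%:Z - 24 * (z + 1).

Definition cell (m : memory) (k : nat) (z : int) : int := m (loc k z).

Definition locE (k : nat) (e : expr) : expr :=
  Op OpSub (Const k%:Z) (Op OpMul (Const 24) (Op OpAdd e (Const 1))).

Definition Arr (k : nat) (e : expr) : expr := Read (locE k e).
Definition Var (k : nat) : expr := Arr k (Const 0).
Definition SetArr (k : nat) (e1 e2 : expr) : program := Store (locE k e1) e2.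
Definition SetVar (k : nat) (e : expr) : program := SetArr k (Const 0) e.

Definition For (v : nat) (e : expr) (c : program) : program :=
  Seq (SetVar v (Const 0))
    (While (Op OpSub e (Var v))
       (Seq c (SetVar v (Op OpAdd (Var v) (Const 1))))).

Lemma eval_Arr m k e : eval m (Arr k e) = cell m k (eval m e).
Proof. by []. Qed.

Lemma eval_Var m k : eval m (Var k) = cell m k 0.
Proof. by []. Qed.

Lemma eval_Add m e1 e2 : eval m (Op OpAdd e1 e2) = eval m e1 + eval m e2.
Proof. by []. Qed.

Lemma eval_Sub m e1 e2 : eval m (Op OpSub e1 e2) = eval m e1 - eval m e2.
Proof. by []. Qed.

Lemma eval_Mul m e1 e2 : eval m (Op OpMul e1 e2) = eval m e1 * eval m e2.
Proof. by []. Qed.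

Lemma eval_Div m e1 e2 :
  eval m (Op OpDiv e1 e2) = (eval m e1 %/ eval m e2)%Z.
Proof. by []. Qed.

Lemma eval_Const m z : eval m (Const z) = z.
Proof. by []. Qed.

Definition evalE := (eval_Arr, eval_Var, eval_Add, eval_Sub, eval_Mul,
  eval_Div, eval_Const).

Lemma cell_update m k z v k' z' : (k < 24)%N -> (k' < 24)%N ->
  cell (update m (loc k z) v) k' z' =
  if (k == k') && (z == z') then v else cell m k' z'.
Proof.
move=> k24 k'24; rewrite /cell /update.
suff -> : (loc k' z' == loc k z) = (k == k') && (z == z') by [].
by rewrite /loc; apply/eqP/andP => [|[/eqP-> /eqP->]] //; lia.
Qed.

Lemma update_loc_input m k (i : nat) v (a : nat) : (k < 24)%N ->
  update m (loc k i%:Z) v a%:Z = m a%:Z.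
Proof. by rewrite /update /loc => ?; case: eqP => //; lia. Qed.

Lemma cell_update_output m (a : nat) v k (i : nat) : (k < 24)%N ->
  cell (update m a%:Z v) k i%:Z = cell m k i%:Z.
Proof. by rewrite /cell /update /loc => ?; case: eqP => //; lia. Qed.

Section ArrayPrograms.

Variables (L B : nat).
Hypothesis B0 : (0 < B)%N.

Lemma wp_set k e1 e2 m (Q : memory -> Prop) :
  (bounded B m -> `|eval m e2| < 2 ^ B)%N ->
  (bounded B m -> Q (update m (loc k (eval m e1)) (eval m e2))) ->
  wp L B (SetArr k e1 e2) m Q.
Proof. exact: wp_store. Qed.

Lemma wp_for v e c (N : nat) (Inv : nat -> memory -> Prop) m
    (Q : memory -> Prop) :
  (v < 24)%N -> (N <= L)%N -> (N < 2 ^ B)%N ->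
  Inv 0%N (update m (loc v 0) 0) ->
  (forall k m, Inv k m -> eval m e = N%:Z) ->
  (forall k m, (k < N)%N -> bounded B m -> Inv k m -> cell m v 0 = k%:Z ->
     wp L B c m (fun m' => cell m' v 0 = k%:Z /\
       Inv k.+1 (update m' (loc v 0) k.+1%:Z))) ->
  (forall m', bounded B m' -> Inv N m' -> Q m') ->
  wp L B (For v e c) m Q.
Proof.
move=> v24 NL NB inv0 eN step stop.
have self m' z : cell (update m' (loc v 0) z) v 0 = z.
  by rewrite cell_update // !eqxx.
apply: wp_seq => //; apply: wp_set => [_|b0]; first by rewrite expn_gt0.
apply: (@wp_while _ _ _ _ _ N (fun k m => Inv k m /\ cell m v 0 = k%:Z)) => //.
- move=> k m' kN b [inv vk]; split.
    by rewrite !evalE (eN k) // vk subr_gt0 ltz_nat.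
  apply: wp_seq => //.
  apply: wp_weaken (step k m' kN b inv vk) _ => m'' b'' [vk' inv'].
  have k1 : k%:Z + 1 = k.+1%:Z by rewrite -addn1.
  apply: wp_set => _; rewrite !evalE vk' k1 //.
  exact: leq_ltn_trans NB.
- move=> m' b [inv vk]; split; last exact: stop.
  by rewrite !evalE (eN N) // vk subrr.
Qed.

End ArrayPrograms.

(** * The local-ratio argument *)

Lemma divz_bounds (m a : int) : 0 < a ->
  (m %/ a)%Z * a <= m /\ m < ((m %/ a)%Z + 1) * a.
Proof.
move=> a0; have dv := divz_eq m a.
have m0 : 0 <= (m %% a)%Z by rewrite modz_ge0 //; lia.
have m1 : (m %% a)%Z < a by rewrite ltz_pmod.
by rewrite mulrDl mul1r; lia.
Qed.

Section Covering.

Variables (n T : nat) (s e : nat -> nat) (w c : nat -> int) (M : nat -> bool).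
Variables (D : nat -> int) (X : int).

Hypothesis s_gt0 : forall i, (i < n)%N -> (0 < s i)%N.
Hypothesis se : forall i, (i < n)%N -> (s i <= e i)%N.
Hypothesis eT : forall i, (i < n)%N -> (e i <= T)%N.
Hypothesis w_ge0 : forall i, (i < n)%N -> 0 <= w i.
Hypothesis w_leX : forall i, (i < n)%N -> w i <= X.
Hypothesis c_ge0 : forall i, (i < n)%N -> 0 <= c i.
Hypothesis c_leX : forall i, (i < n)%N -> c i <= X.
Hypothesis D_ge0 : forall t, 0 <= D t.
Hypothesis D_leX : forall t, D t <= X.
Hypothesis X_ge1 : 1 <= X.

Definition act (i t : nat) : bool := (s i <= t <= e i)%N.

Definition cap (x : nat -> int) (t : nat) : int :=
  \sum_(i < n | act i t) w i * x i.

Definition deficit (x : nat -> int) (t : nat) : int := D t - cap x t.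

Definition covers (y : nat -> int) : Prop :=
  [/\ forall i, (i < n)%N -> 0 <= y i,
      forall i, (i < n)%N -> ~~ M i -> y i <= 1 &
      forall t, (t <= T)%N -> deficit y t <= 0].

Definition peak (x : nat -> int) (t : nat) (d : int) : Prop :=
  [/\ (t <= T)%N, 0 <= d, d = deficit x t &
      forall t', (t' <= T)%N -> deficit x t' <= d].

(* The reduced weight of resource [i] when [t] is the slot of largest deficit
   [d] and the resources [i'] with [x i' != 0] have already been selected. *)
Definition delta (x : nat -> int) (t : nat) (d : int) (i : nat) : int :=
  if act i t && (x i == 0) then Num.min (w i) d else 0.

(** For an M-type resource this is the ceiling of [d / w i], the least number of copies whose
    capacity reaches [d]. *)
Definition copies (d : int) (i : nat) : int :=
  if M i then ((d + w i - 1) %/ w i)%Z else 1.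

(* [p] holds the residual costs up to a common positive factor, which keeps them
   integral: the subtraction of the multiple [p j / delta j] of [delta] is
   multiplied by [delta j]. *)
Definition forward_step (p x p' x' : nat -> int) (o : option nat) : Prop :=
  exists t d, peak x t d /\
  if o is Some j then
    [/\ (j < n)%N, 0 < delta x t d j,
        forall i, (i < n)%N -> p j * delta x t d i <= p i * delta x t d j,
        forall i, (i < n)%N -> p' i = p i * delta x t d j - p j * delta x t d i &
        forall i, (i < n)%N -> x' i = if i == j then copies d j else x i]
  else
    [/\ forall i, (i < n)%N -> delta x t d i <= 0,
        forall i, (i < n)%N -> p' i = p i &
        forall i, (i < n)%N -> x' i = x i].

(** The factor 2 comes from rounding up: the least number of copies reaching [d] has total capacity
    below [d + w i]. These bounds keep multiplicities and deficits short. *)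
Definition small (x : nat -> int) : Prop :=
  forall i, (i < n)%N -> [/\ 0 <= x i, x i <= X & w i * x i <= 2 * X].

(** The exponent counts rounds, each of which multiplies residual costs by a reduced weight of at
    most [X]. The last clause is what the knapsack cover inequality uses about selected
    resources. *)
Definition forward_inv (k : nat) (p x : nat -> int) : Prop :=
  [/\ forall i, (i < n)%N -> 0 <= p i <= X ^+ k.+1, small x &
      forall i, (i < n)%N -> 0 < x i ->
        if M i then forall t, act i t -> deficit x t <= 0 else x i = 1].

Lemma eq_cap x x' t :
  (forall i, (i < n)%N -> x i = x' i) -> cap x t = cap x' t.
Proof. by move=> xx'; apply: eq_bigr => i _; rewrite xx'. Qed.

Lemma deficit_set x x' j t : (j < n)%N ->
  (forall i, (i < n)%N -> i != j -> x' i = x i) ->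
  deficit x' t = deficit x t - (if act j t then w j * (x' j - x j) else 0).
Proof.
move=> jn xx'; rewrite /deficit /cap !(big_mkcond (fun i : 'I_n => act i t)) /=.
rewrite (bigD1 (Ordinal jn)) //= [in RHS](bigD1 (Ordinal jn)) //=.
rewrite (eq_bigr (fun i : 'I_n => if act i t then w i * x i else 0)).
  by case: (act j t); ring.
by move=> i ij; rewrite xx'.
Qed.

Lemma small_deficit x t : small x -> - (2 * n%:Z * X) <= deficit x t <= X.
Proof.
move=> sx; have [Dt DX] := (D_ge0 t, D_leX t).
have cap0 : 0 <= cap x t.
  apply: sumr_ge0 => i _; have [x0 _ _] := sx i (ltn_ord i).
  by rewrite mulr_ge0 // w_ge0.
have capX : cap x t <= 2 * n%:Z * X.
  apply: le_trans (_ : \sum_(i < n) 2 * X <= _).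
    rewrite /cap big_mkcond; apply: ler_sum => i _; case: ifP => _.
      by have [] := sx i (ltn_ord i).
    by lia.
  by rewrite sumr_const card_ord -mulr_natr natz; lia.
rewrite /deficit; lia.
Qed.

Lemma delta_ge0 x t d i : (i < n)%N -> 0 <= d -> 0 <= delta x t d i.
Proof.
by move=> iN d0; rewrite /delta; case: ifP => // _; rewrite le_min w_ge0.
Qed.

Lemma delta_leX x t d i : (i < n)%N -> delta x t d i <= X.
Proof.
move=> iN; rewrite /delta; case: ifP => // _; last by lia.
by apply: le_trans (w_leX iN); rewrite ge_min lexx.
Qed.

Lemma delta_gt0 x t d i : 0 < delta x t d i ->
  [/\ act i t, x i = 0, 0 < w i & 0 < d].
Proof.
by rewrite /delta; case: ifP => // /andP[-> /eqP->]; rewrite lt_min => /andP[].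
Qed.

Lemma copies_bounds d j : 0 < d -> d <= X -> 0 < w j -> w j <= X ->
  [/\ 0 < copies d j, copies d j <= X, w j * copies d j <= 2 * X &
      M j -> d <= w j * copies d j].
Proof.
move=> d0 dX w0 wX; rewrite /copies; case: (M j); last by split => //; lia.
have dv := divz_eq (d + w j - 1) (w j).
have m0 : 0 <= ((d + w j - 1) %% w j)%Z by rewrite modz_ge0 //; lia.
have m1 : ((d + w j - 1) %% w j)%Z < w j by rewrite ltz_pmod.
move: dv m0 m1; set q := (_ %/ _)%Z; set r := (_ %% _)%Z => dv m0 m1.
have q0 : 0 < q by nia.
by split => //; nia.
Qed.

(** Since [d] is the largest deficit over all slots, copies of an M-type resource that absorb [d]
    clear its whole interval, and later selections only lower deficits. Minimality of the ratio at
    [j] keeps the new residual costs nonnegative. *)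
Lemma forward_invS k p x p' x' o :
  forward_inv k p x -> forward_step p x p' x' o -> forward_inv k.+1 p' x'.
Proof.
move=> [pk sx sel] [t [d [[tT d0 dt pk_t]]]].
have Xk : 1 <= X ^+ k.+1 by rewrite exprn_ege1.
case: o => [j [jn dj min_j p'E x'E]|[_ p'E x'E]].
- have [aj xj wj d1] := delta_gt0 dj.
  have dX : d <= X by have := small_deficit t sx; lia.
  have [c0 cX wcX cM] := copies_bounds d1 dX wj (w_leX jn).
  have x'j : x' j = copies d j by rewrite x'E // eqxx.
  have defE t' : deficit x' t' =
      deficit x t' - (if act j t' then w j * copies d j else 0).
    rewrite (@deficit_set x x' j) // ?x'j ?xj ?subr0 // => i iN /negPf ij.
    by rewrite x'E // ij.
  split=> [i iN|i iN|i iN].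
  + rewrite p'E // subr_ge0 min_j //=.
    have /andP[pi0 piX] := pk i iN; have /andP[pj0 _] := pk j jn.
    have di := delta_ge0 x t iN d0; have djX := delta_leX x t d jn.
    apply: le_trans (_ : p i * delta x t d j <= _).
      by rewrite gerBl mulr_ge0.
    by rewrite [X ^+ k.+2]exprSr; apply: ler_pM => //; apply: ltW.
  + rewrite x'E //; case: eqP => [->|_]; last exact: sx.
    by split => //; apply: ltW.
  + rewrite x'E //; case: eqP => [->|_ xi].
      move=> _; case Mj: (M j); last by rewrite /copies Mj.
      move=> t' at'; rewrite defE at'; have := cM Mj; have := pk_t t'.
      have t'T : (t' <= T)%N by have := eT jn; move: at'; rewrite /act; lia.
      by move=> /(_ t'T); lia.
    have := sel i iN xi; case: (M i) => // di t' /di; rewrite defE.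
    by case: ifP => _; nia.
- have defE t' : deficit x' t' = deficit x t'.
    by rewrite /deficit (eq_cap _ x'E).
  split=> [i iN|i iN|i iN].
  + rewrite p'E //; have /andP[-> /= piX] := pk i iN.
    by rewrite [X ^+ k.+2]exprSr; apply: le_trans piX _; nia.
  + by rewrite x'E //; apply: sx.
  + rewrite x'E // => xi; have := sel i iN xi; case: (M i) => // di t' /di.
    by rewrite defE.
Qed.

Lemma deficit_forward_step k p x p' x' o t :
  forward_inv k p x -> forward_step p x p' x' o -> deficit x' t <= deficit x t.
Proof.
move=> [_ sx _] [t0 [d [[_ _ dt _]]]].
case: o => [j [jn dj _ _ x'E]|[_ _ x'E]]; last first.
  by rewrite /deficit (eq_cap _ x'E).
have [aj xj wj d1] := delta_gt0 dj.
have dX : d <= X by have := small_deficit t0 sx; lia.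
have [c0 _ _ _] := copies_bounds d1 dX wj (w_leX jn).
rewrite (@deficit_set x x' j) // => [|i iN /negPf ij]; rewrite x'E ?ij //.
by rewrite eqxx xj subr0; case: ifP => _; nia.
Qed.

(* Knapsack cover inequality: for a selected M-type resource active at [t] the
   deficit would not be positive, and [y] has at most the copy in [x] of a
   selected S-type resource. *)
Lemma peak_le_delta k p x t d y :
  forward_inv k p x -> peak x t d -> covers y ->
  d <= \sum_(i < n) delta x t d i * y i.
Proof.
move=> [_ sx sel] [tT d0 dt _] [y0 y1 yc].
have term0 (i : 'I_n) : 0 <= delta x t d i * y i.
  by rewrite mulr_ge0 ?delta_ge0 ?y0.
have [d1|d1] := lerP d 0; first by apply: le_trans d1 (sumr_ge0 _ _).
have dY : d <= \sum_(i < n) if act i t && (x i == 0) then w i * y i else 0.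
  apply: le_trans (_ : cap y t - cap x t <= _).
    by have := yc t tT; move: dt; rewrite /deficit; lia.
  rewrite /cap !(big_mkcond (fun i : 'I_n => act i t)) /= -sumrB.
  apply: ler_sum => i _; case ai: (act i t) => //=.
  have iN := ltn_ord i; have [x0 _ _] := sx i iN.
  case: eqP => [->|xi]; first by rewrite mulr0 subr0.
  have xi0 : 0 < x i by lia.
  have := sel i iN xi0; case Mi: (M i); first by move/(_ t ai); lia.
  move=> ->; have := y1 i iN; rewrite Mi => /(_ isT).
  by have := w_ge0 iN; nia.
(* If [y] uses an unselected active resource of weight at least [d], that term alone contributes
   [d]. Otherwise every such resource used by [y] has weight below [d], and truncation changes
   nothing. *)
case: (pickP (fun i : 'I_n => [&& act i t, x i == 0, d <= w i & 1 <= y i])).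
- move=> i /and4P[ai xi dw yi]; rewrite (bigD1 i) //=.
  rewrite -[d in d <= _]addr0; apply: lerD; last exact: sumr_ge0.
  by rewrite /delta ai xi /= min_r //; nia.
- move=> none; apply: le_trans dY _; apply: ler_sum => i _.
  rewrite /delta; case: ifP => [/andP[ai xi]|_]; last by rewrite mul0r.
  have := none i; rewrite ai xi /=; have := y0 i (ltn_ord i).
  by case: (lerP (w i) d) => //= h1 h2 h3; nia.
Qed.

(** * The charge of one round on a pruned solution *)

Section Minimal.

Variables (x0 x : nat -> int) (t : nat) (d : int).
Hypothesis peak_x0 : peak x0 t d.
Hypothesis x_ge0 : forall i, (i < n)%N -> 0 <= x i.
Hypothesis x0_ge0 : forall i, (i < n)%N -> 0 <= x0 i.
Hypothesis x0x : forall i, (i < n)%N -> 0 < x0 i -> x i = x0 i.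

(** Without one copy of [i0] the slot [t0] would be uncovered. So the capacity in [Q], all of it
    added to [x0] at [t0], is less than the deficit of [x0] there plus [w i0], hence less than
    [d + w i0]. One copy of [i0] is charged at most [d]; the rest is charged at most its capacity,
    which is below [d]. *)
Lemma one_side (Q : pred 'I_n) (i0 : 'I_n) (t0 : nat) :
  (t0 <= T)%N -> Q i0 -> 0 < x i0 -> 0 < deficit x t0 + w i0 ->
  (forall i, Q i -> act i t0 && (x0 i == 0)) ->
  \sum_(i < n | Q i) delta x0 t d i * x i <= 2 * d.
Proof.
case: peak_x0 => _ d0 _ x0d t0T Qi0 xi0 crit Qt0.
have dw i : (i < n)%N -> delta x0 t d i <= w i.
  move=> iN; rewrite /delta; case: ifP => _; last exact: w_ge0.
  by rewrite ge_min lexx.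
(* Resources outside [Q] do no harm: where [x0] is positive the copies in [x] and [x0] cancel,
   elsewhere [x] adds nonnegative capacity. *)
have sumQ : \sum_(i < n | Q i) w i * x i <= deficit x0 t0 - deficit x t0.
  have -> : deficit x0 t0 - deficit x t0 = cap x t0 - cap x0 t0.
    by rewrite /deficit; ring.
  rewrite /cap big_mkcond !(big_mkcond (fun i : 'I_n => act i t0)) -sumrB.
  apply: ler_sum => i _ /=.
  have iN := ltn_ord i; have [xi x0i] := (x_ge0 iN, x0_ge0 iN).
  case: ifP => [/Qt0/andP[-> /eqP->]|_]; first by rewrite mulr0 subr0.
  case: ifP => [_|//]; have wi := w_ge0 iN.
  have [|x0i0] := lerP (x0 i) 0; first by move=> h; nia.
  by rewrite x0x // subrr.
have rest : \sum_(i < n | Q i && (i != i0)) delta x0 t d i * x i <=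
            \sum_(i < n | Q i && (i != i0)) w i * x i.
  by apply: ler_sum => i _; apply: ler_wpM2r; rewrite ?x_ge0 ?dw.
rewrite (bigD1 i0) //= in sumQ; rewrite (bigD1 i0) //=.
have := x0d t0 t0T.
have : delta x0 t d i0 * (x i0 - 1) <= w i0 * (x i0 - 1).
  by apply: ler_wpM2r; [lia | exact: dw].
have : delta x0 t d i0 <= d.
  by rewrite /delta; case: ifP => // _; rewrite ge_min lexx orbT.
rewrite !mulrBr !mulr1; move: crit rest sumQ.
by lra.
Qed.

Hypothesis x_min : forall i, (i < n)%N -> x0 i = 0 -> 0 < x i ->
  exists2 t', (t' <= T)%N & act i t' /\ 0 < deficit x t' + w i.

(* Every selected copy has a slot where it is indispensable. Among the resources
   with such a slot on one side of [t], all are active at the slot nearest to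
   [t], so without one of them their weight is less than [d]. *)
Lemma delta_le_peak : \sum_(i < n) delta x0 t d i * x i <= 4 * d.
Proof.
case: (peak_x0) => _ d0 _ _.
pose U (i : 'I_n) := [&& act i t, x0 i == 0 & 0 < x i].
pose crit (i : 'I_n) (t' : nat) := act i t' && (0 < deficit x t' + w i).
(* A resource with indispensable slots on both sides, or at [t] itself, counts as left; the other
   class then has all its slots strictly beyond [t]. *)
pose Lf (i : 'I_n) := [exists t' : 'I_T.+1, (t' <= t)%N && crit i t'].
have -> : \sum_(i < n) delta x0 t d i * x i =
          \sum_(i < n | U i) delta x0 t d i * x i.
  rewrite [RHS]big_mkcond; apply: eq_bigr => i _; rewrite /U /delta.
  case: act => //=; last by rewrite mul0r.
  case: eqP => //= _; last by rewrite mul0r.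
  have [//|xi] := ltrP 0 (x i).
  have x0i := x_ge0 (ltn_ord i); have -> : x i = 0 by lia.
  by rewrite mulr0.
rewrite (bigID Lf) /=.
suff [sL sR] : \sum_(i < n | U i && Lf i) delta x0 t d i * x i <= 2 * d /\
               \sum_(i < n | U i && ~~ Lf i) delta x0 t d i * x i <= 2 * d.
  by move: sL sR; lra.
split.
- pose C (t' : 'I_T.+1) := (t' <= t)%N && [exists i, U i && crit i t'].
  case: (pickP C) => [t1 Ct1|noC]; last first.
    rewrite big_pred0 => [|i]; first lia.
    apply/negbTE/negP => /andP[Ui /existsP[t' /andP[t't cr]]].
    have := noC t'; rewrite /C t't /= => /negbT/existsP[].
    by exists i; rewrite Ui.
  case: (@arg_maxnP _ t1 C (fun t' => nat_of_ord t') Ct1) => t0.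
  move=> /andP[t0t /existsP[i0 /andP[Ui0 cr0]]] t0max.
  apply: (@one_side _ i0 t0); rewrite -1?ltnS //.
  + apply/andP; split=> //; apply/existsP; exists t0; exact/andP.
  + by case/and3P: Ui0.
  + by case/andP: cr0.
  + move=> i /andP[Ui /existsP[t' /andP[t't cr]]].
    have := t0max t'; rewrite /C t't /= => t0m.
    have {t0m} : (t' <= t0)%N by apply: t0m; apply/existsP; exists i; rewrite Ui.
    case/and3P: Ui => ai -> _; case/andP: cr => ai' _.
    by move: ai ai'; rewrite /act; lia.
- have critR i : U i -> ~~ Lf i -> exists2 t' : 'I_T.+1, crit i t' & (t < t')%N.
    move=> Ui /existsP nL; case/and3P: (Ui) => _ /eqP x0i xi.
    have [t' t'T [ai cr]] := x_min (ltn_ord i) x0i xi.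
    have t'T1 : (t' < T.+1)%N by [].
    exists (Ordinal t'T1); first exact/andP.
    rewrite ltnNge; apply/negP => t't; case: nL; exists (Ordinal t'T1).
    by apply/andP; split => //; apply/andP.
  pose C (t' : 'I_T.+1) := (t < t')%N && [exists i, [&& U i, ~~ Lf i & crit i t']].
  case: (pickP C) => [t1 Ct1|noC]; last first.
    rewrite big_pred0 => [|i]; first lia.
    apply/negbTE/negP => /andP[Ui nL]; have [t' cr tt'] := critR i Ui nL.
    have := noC t'; rewrite /C tt' /= => /negbT/existsP[].
    by exists i; rewrite Ui nL.
  case: (@arg_minnP _ t1 C (fun t' => nat_of_ord t') Ct1) => t0.
  move=> /andP[t0t /existsP[i0 /and3P[Ui0 nL0 cr0]]] t0min.
  apply: (@one_side _ i0 t0); rewrite -1?ltnS //.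
  + exact/andP.
  + by case/and3P: Ui0.
  + by case/andP: cr0.
  + move=> i /andP[Ui nL]; have [t' cr tt'] := critR i Ui nL.
    have := t0min t'; rewrite /C tt' /= => t0m.
    have {t0m} : (t0 <= t')%N.
      by apply: t0m; apply/existsP; exists i; rewrite Ui nL.
    case/and3P: Ui => ai -> _; case/andP: cr => ai' _.
    by move: ai ai' t0t; rewrite /act; lia.
Qed.

End Minimal.

(** The residual costs and the selection before every round are recorded, since the analysis of the
    backward pass refers to them while the program has overwritten them and logs only which resource
    each round selected. *)
Definition history (k : nat) (Hp Hx : nat -> nat -> int)
    (Ho : nat -> option nat) : Prop :=
  [/\ forall i, (i < n)%N -> Hp 0%N i = c i,
      forall i, (i < n)%N -> Hx 0%N i = 0 &
      forall k', (k' < k)%N ->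
        forward_step (Hp k') (Hx k') (Hp k'.+1) (Hx k'.+1) (Ho k')].

Lemma history_inv k Hp Hx Ho : history k Hp Hx Ho ->
  forall k', (k' <= k)%N -> forward_inv k' (Hp k') (Hx k').
Proof.
move=> [p0 x0 stp]; elim=> [_|k' IH k'k].
  split=> [i iN|i iN|i iN]; rewrite ?p0 ?x0 //.
  - by rewrite expr1 c_ge0 // c_leX.
  - by split; rewrite ?mulr0; lia.
exact: forward_invS (IH (ltnW k'k)) (stp k' k'k).
Qed.

(** [m] is the minimum of the capacity of the copies of [j] and of the slacks on its interval, given
    as an attained lower bound. The guard [0 < m] matters on infeasible instances: a remaining
    positive deficit makes [m] negative, and its quotient would add copies. *)
Definition backward_step (x x' : nat -> int) (j : nat) : Prop :=
  exists m, [/\ m <= w j * x j,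
    forall t, (t <= T)%N -> act j t -> m <= - deficit x t,
    m = w j * x j \/
      (exists2 t, (t <= T)%N & act j t /\ m = - deficit x t) &
    forall i, (i < n)%N ->
      x' i = if i == j then x j - (if 0 < m then (m %/ w j)%Z else 0) else x i].

Lemma backward_step_small x x' j : (j < n)%N -> small x ->
  backward_step x x' j -> small x'.
Proof.
move=> jn sx [m [mwx _ _ x'E]] i iN; have [x0 xX wxX] := sx i iN.
rewrite x'E //; case: eqP => // ij; rewrite -ij in mwx *.
case: ifP => [m0|_]; last by rewrite subr0.
have w0 : 0 < w i by have := w_ge0 iN; nia.
have [q1 q2] := divz_bounds m w0.
have q0 : 0 <= (m %/ w i)%Z by rewrite divz_ge0 // ltW.
by split; nia.
Qed.

(** * The local-ratio induction over the rounds in reverse order *)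

Section Backward.

Variables (Hp Hx : nat -> nat -> int) (Ho : nat -> option nat) (y : nat -> int).
Hypothesis hist : history n Hp Hx Ho.
Hypothesis y_covers : covers y.

(** A positive reduced weight requires that no copy is selected yet, so each effective round
    enlarges the set of selected resources. A round without effect has zero charges, and then the
    lower bound given by [y] forces all deficits to be nonpositive. *)
Lemma history_covered t : (t <= T)%N -> deficit (Hx n) t <= 0.
Proof.
pose done k := forall t, (t <= T)%N -> deficit (Hx k) t <= 0.
suff [|all_sel] : done n \/ (n <= #|[set i : 'I_n | (0 < Hx n i)%R]|)%N.
- exact.
- move=> tT; have [p0 sx sel] := history_inv hist (leqnn n).
  have {all_sel} pos i : (i < n)%N -> 0 < Hx n i.
    move=> iN; have : [set i : 'I_n | (0 < Hx n i)%R] == [set: 'I_n].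
      by rewrite eqEcard subsetT cardsT card_ord.
    by move=> /eqP/setP/(_ (Ordinal iN)); rewrite !inE.
  (* With everything selected, a slot of positive deficit has no active M-type resource and already
     has the single copy of each active S-type resource, so [y] could not cover it either. *)
  rewrite leNgt; apply/negP => dt.
  have := y_covers; case=> y0 y1 yc; have := yc t tT.
  apply/negP; rewrite -ltNge; apply: lt_le_trans (dt) _.
  rewrite /deficit lerD2l lerN2; apply: ler_sum => i ai.
  have iN := ltn_ord i; apply: ler_wpM2l; first exact: w_ge0.
  have := sel i iN (pos i iN); case Mi: (M i).
    by move=> /(_ t ai); lia.
  by move=> ->; apply: y1; rewrite ?Mi.
suff gen k : (k <= n)%N ->
    done k \/ (k <= #|[set i : 'I_n | (0 < Hx k i)%R]|)%N by exact: gen.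
elim: k => [|k IH] kn; first by right.
have stp : forward_step (Hp k) (Hx k) (Hp k.+1) (Hx k.+1) (Ho k).
  by case: hist => _ _; apply.
have inv := history_inv hist (ltnW kn).
have [dn|card_k] := IH (ltnW kn).
  left=> t' t'T; apply: le_trans (dn t' t'T).
  exact: deficit_forward_step inv stp.
have [t' [d [pk]]] := stp; case: (Ho k) => [j [jn dj _ _ x'E]|[d0 _ x'E]].
- right; apply: leq_ltn_trans card_k _; apply: proper_card.
  have [aj xj wj d1] := delta_gt0 dj.
  have dX : d <= X.
    by case: inv => _ sx _; case: pk => _ _ -> _; have := small_deficit t' sx; lia.
  have [c0 _ _ _] := copies_bounds d1 dX wj (w_leX jn).
  rewrite properE; apply/andP; split.
    apply/subsetP => i; rewrite !inE x'E //; case: eqP => [->|//].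
    by rewrite xj.
  apply/negP => /subsetP/(_ (Ordinal jn)); rewrite !inE /= x'E // eqxx xj.
  by rewrite ltxx => /(_ c0).
- left=> t'' t''T; rewrite (_ : deficit _ _ = deficit (Hx k) t'').
    case: (pk) => _ _ _ /(_ t'' t''T) pk'; apply: le_trans pk' _.
    apply: le_trans (peak_le_delta inv pk y_covers) _.
    apply: sumr_le0 => i _; case: y_covers => y0 _ _.
    by apply: mulr_le0_ge0; [apply: d0 | apply: y0].
  by rewrite /deficit (eq_cap _ x'E).
Qed.

(* The last clause compares the costs, with respect to the residual costs before
   step [k], of what was selected from step [k] on. *)
Definition backward_inv (k : nat) (x : nat -> int) : Prop :=
  [/\ forall i, (i < n)%N -> 0 <= x i <= Hx n i,
      forall i, (i < n)%N -> 0 < Hx k i -> x i = Hx k i,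
      forall t, (t <= T)%N -> deficit x t <= 0,
      forall i, (i < n)%N -> Hx k i = 0 -> 0 < x i ->
        exists2 t, (t <= T)%N & act i t /\ 0 < deficit x t + w i &
      \sum_(i < n | Hx k i == 0) Hp k i * x i <=
        4 * \sum_(i < n | Hx k i == 0) Hp k i * y i].

Lemma backward_inv_start : backward_inv n (Hx n).
Proof.
have [p0 sx sel] := history_inv hist (leqnn n).
split=> [i iN|//|t tT|i iN ->|]; rewrite ?lexx ?ltxx //.
- by rewrite andbT; case: (sx i iN).
- exact: history_covered.
- rewrite big1 => [|i /eqP->]; last by rewrite mulr0.
  rewrite mulr_ge0 //; apply: sumr_ge0 => i _; case: y_covers => y0 _ _.
  by rewrite mulr_ge0 ?y0 //; case/andP: (p0 i (ltn_ord i)).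
Qed.

Lemma backward_inv_none k x : (k < n)%N -> Ho k = None ->
  backward_inv k.+1 x -> backward_inv k x.
Proof.
move=> kn Hk [x_n x_k x_cov x_min cst].
have : forward_step (Hp k) (Hx k) (Hp k.+1) (Hx k.+1) (Ho k).
  by case: hist => _ _; apply.
rewrite Hk => -[t [d [_ [_ pE xE]]]].
split=> // [i iN|i iN|]; rewrite -?xE //; [exact: x_k | exact: x_min |].
have sumE z : \sum_(i < n | Hx k i == 0) Hp k i * z i =
              \sum_(i < n | Hx k.+1 i == 0) Hp k.+1 i * z i :> int.
  by apply: eq_big => i; rewrite ?xE // pE.
by rewrite !sumE.
Qed.

(** Scaled by the reduced weight of [j], the residual costs of round [k] split into those of round
    [k.+1] and a multiple of the charge. The ratio 4 holds for the first part by induction and for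
    the second by the two bounds on the charge. *)
Lemma backward_inv_some k x x' j : (k < n)%N -> Ho k = Some j ->
  backward_inv k.+1 x -> backward_step x x' j -> backward_inv k x'.
Proof.
move=> kn Hk [x_n x_k x_cov x_min cst] [m [m1 m2 m3 x'E]].
have : forward_step (Hp k) (Hx k) (Hp k.+1) (Hx k.+1) (Ho k).
  by case: hist => _ _; apply.
rewrite Hk => -[t [d [pk [jn dj _ pE xE]]]].
have inv := history_inv hist (ltnW kn).
have [pk0 sxk _] := inv.
have [aj xj wj d1] := delta_gt0 dj.
have dX : d <= X.
  by case: pk => _ _ -> _; have := small_deficit t sxk; lia.
have [c0 _ _ _] := copies_bounds d1 dX wj (w_leX jn).
have Hxj : 0 < Hx k.+1 j by rewrite xE // eqxx.
have xj0 : 0 < x j by rewrite x_k.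
have m0 : 0 <= m.
  by case: m3 => [->|[t' t'T [_ ->]]]; [nia | rewrite oppr_ge0 x_cov].
have [q1 q2] := divz_bounds m wj.
set q := (m %/ w j)%Z in q1 q2.
have q0 : 0 <= q by rewrite divz_ge0.
have {}x'E i : (i < n)%N -> x' i = if i == j then x j - q else x i.
  move=> iN; rewrite x'E //; case: eqP => // _; case: ltrP => // m_le0.
  have m00 : m = 0 by lia.
  by rewrite /q m00 div0z.
have x'j : x' j = x j - q by rewrite x'E // eqxx.
have defE t' : deficit x' t' = deficit x t' + (if act j t' then w j * q else 0).
  rewrite (@deficit_set x x' j) // => [|i iN /negPf ij]; rewrite x'E ?ij //.
  by rewrite eqxx; case: ifP => _; lia.
have x'_ge0 i : (i < n)%N -> 0 <= x' i.
  move=> iN; rewrite x'E //; case: eqP => [_|_]; first nia.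
  by case/andP: (x_n i iN).
have xk i : (i < n)%N -> 0 < Hx k i -> x' i = Hx k i.
  move=> iN xi; have ij : i != j by apply: contraTneq xi => ->; rewrite xj.
  by rewrite x'E // (negPf ij) x_k // xE // (negPf ij).
(* For [j], rounding [m / w j] down leaves less than [w j] of slack at a tight slot, while
   [m = w j * x j] would have left no copy. For the others, removing copies only raises deficits, so
   indispensable slots remain so. *)
have x'_min i : (i < n)%N -> Hx k i = 0 -> 0 < x' i ->
    exists2 t, (t <= T)%N & act i t /\ 0 < deficit x' t + w i.
  move=> iN xi; rewrite x'E //; case: eqP => [-> xq|/eqP/negPf ij x'i].
    case: m3 => [mE|[t' t'T [aj' mE]]]; first by nia.
    by exists t' => //; split=> //; rewrite defE aj'; lia.
  have xi' : Hx k.+1 i = 0 by rewrite xE // ij.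
  have [t' t'T [ai cr]] := x_min i iN xi' x'i.
  exists t' => //; split=> //; rewrite defE; case: ifP => _; last lia.
  have : 0 <= w j * q by rewrite mulr_ge0 // ltW.
  by lia.
split=> // [i iN|t' t'T|].
- rewrite x'_ge0 //= x'E //; case: eqP => [ij|_].
    by rewrite -ij; have /andP[_] := x_n i iN; lia.
  by case/andP: (x_n i iN).
- rewrite defE; have := x_cov t' t'T; case: ifP => [/(m2 t' t'T)|_]; lia.
(* The index sets differ only in [j], whose residual cost drops to 0, so the charge carries its
   whole term; the charge vanishes on resources selected earlier. *)
have costE z : delta (Hx k) t d j * (\sum_(i < n | Hx k i == 0) Hp k i * z i) =
    \sum_(i < n | Hx k.+1 i == 0) Hp k.+1 i * z i +
    Hp k j * (\sum_(i < n) delta (Hx k) t d i * z i).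
  rewrite !mulr_sumr !(big_mkcond (fun i : 'I_n => Hx _ i == 0)) -big_split /=.
  apply: eq_bigr => i _; rewrite pE // xE //.
  case: (eqVneq (i : nat) j) => [->|ij].
    by rewrite xj eqxx gt_eqF //; ring.
  case: eqP => [_|/eqP xi]; first by ring.
  by rewrite /delta (negPf xi) andbF; ring.
have cost_x : \sum_(i < n | Hx k.+1 i == 0) Hp k.+1 i * x' i =
              \sum_(i < n | Hx k.+1 i == 0) Hp k.+1 i * x i.
  apply: eq_bigr => i /eqP xi; rewrite x'E //; case: eqP => // ij.
  by move: xi Hxj; rewrite ij => ->; rewrite ltxx.
rewrite -(ler_pM2l dj) mulrCA !costE cost_x.
have pj0 : 0 <= Hp k j by case/andP: (pk0 j jn).
have ub : \sum_(i < n) delta (Hx k) t d i * x' i <= 4 * d.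
  apply: delta_le_peak pk x'_ge0 _ xk x'_min => i iN.
  by case: (sxk i iN).
have lb := peak_le_delta inv pk y_covers.
have := ler_wpM2l pj0 (_ : \sum_(i < n) delta (Hx k) t d i * x' i <=
  4 * \sum_(i < n) delta (Hx k) t d i * y i).
by move=> /(_ ltac:(lra)); move: cst; rewrite mulrDr mulrCA; lra.
Qed.

(** Before round 0 nothing is selected, so the residual comparison is one of full costs. The limit
    on S-type copies is inherited from the forward selection, which pruning only diminishes. *)
Lemma backward_inv_end x : backward_inv 0%N x ->
  covers x /\ \sum_(i < n) c i * x i <= 4 * \sum_(i < n) c i * y i.
Proof.
case: (hist) => Hp0 Hx0 _ [x_n _ x_cov _].
have [_ _ sel] := history_inv hist (leqnn n).
have all0 z : \sum_(i < n | Hx 0%N i == 0) Hp 0%N i * z i =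
    \sum_(i < n) c i * z i :> int.
  by apply: eq_big => i; rewrite ?Hx0 ?eqxx // Hp0.
rewrite !all0; split=> //; split=> // i iN; have /andP[xi0 xin] := x_n i iN => //.
move=> Mi.
have [|xi] := lerP (Hx n i) 0; first lia.
by have := sel i iN xi; rewrite (negPf Mi); lia.
Qed.

End Backward.
End Covering.

(** * The covering program *)

Lemma cell_same m k z v : cell (update m (loc k z) v) k z = v.
Proof. by rewrite /cell /update eqxx. Qed.

Lemma cell_other m k z v k' z' : (k < 24)%N -> (k' < 24)%N -> k != k' ->
  cell (update m (loc k z) v) k' z' = cell m k' z'.
Proof. by move=> k24 k'24 /negPf kk'; rewrite cell_update // kk'. Qed.

(** An array in [ks] is left free at all indices, including the negative ones, where input cells
    lie. *)
Definition frame (ks : seq nat) (m m' : memory) : Prop :=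
  forall k z, (k < 24)%N -> k \notin ks -> cell m' k z = cell m k z.

Lemma frame_refl ks m : frame ks m m.
Proof. by []. Qed.

Lemma frame_update ks m m' k z v : (k < 24)%N -> k \in ks ->
  frame ks m m' -> frame ks m (update m' (loc k z) v).
Proof.
move=> k24 kks fr k' z' k'24 k'ks; rewrite cell_other ?fr //.
by apply: contraNneq k'ks => <-.
Qed.

Lemma frame_trans ks m m' m'' :
  frame ks m m' -> frame ks m' m'' -> frame ks m m''.
Proof. by move=> f1 f2 k z k24 kks; rewrite f2 // f1. Qed.

Lemma frame_sub ks ks' m m' :
  all (mem ks') ks -> frame ks m m' -> frame ks' m m'.
Proof.
move=> /allP sub fr k z k24 kks'; apply: fr => //.
by apply: contraNN kks'; apply: sub.
Qed.

Ltac simpl_cells :=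
  repeat match goal with
  | |- context [cell (update ?m (loc ?k ?z) ?v) ?k' ?z'] =>
      first [ rewrite (@cell_other m k z v k' z' isT isT isT)
            | rewrite (@cell_same m k z v) ]
  end.

Ltac use_frame F :=
  repeat match goal with
  | |- context [cell ?m ?k ?z] => rewrite (F k z isT isT)
  end.

Ltac solve_frame :=
  repeat first
    [ assumption
    | exact: frame_refl
    | apply: frame_update; [by [] | by [] | ] ].

Lemma wp_for_frame (L B : nat) v e c (N : nat) ks (Inv : nat -> memory -> Prop)
    m (Q : memory -> Prop) :
  (0 < B)%N -> (v < 24)%N -> v \in ks -> (N <= L)%N -> (N < 2 ^ B)%N ->
  (forall m', frame ks m m' -> eval m' e = N%:Z) ->
  (forall k m' z, Inv k m' -> Inv k (update m' (loc v 0) z)) ->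
  Inv 0%N m ->
  (forall k m', (k < N)%N -> frame ks m m' -> Inv k m' ->
     cell m' v 0 = k%:Z ->
     wp L B c m' (fun m'' =>
       [/\ frame ks m' m'', cell m'' v 0 = k%:Z & Inv k.+1 m''])) ->
  (forall m', frame ks m m' -> Inv N m' -> Q m') ->
  wp L B (For v e c) m Q.
Proof.
move=> B0 v24 vks NL NB eN stable inv0 step stop.
apply: (@wp_for _ _ B0 _ _ _ N (fun k m' => frame ks m m' /\ Inv k m')) => //.
- by split; [solve_frame; apply: frame_update | apply: stable].
- by move=> k m' [fr _]; apply: eN.
- move=> k m' kN b [fr inv] vk.
  apply: wp_weaken (step k m' kN fr inv vk) _ => m'' _ [fr' vk' inv'].
  split=> //; split; last exact: stable.
  by apply: frame_update => //; apply: frame_trans fr'.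
- by move=> m' _ [fr inv]; apply: stop.
Qed.

Lemma wp_if_bool (L B : nat) (b : bool) e c1 c2 m (Q : memory -> Prop) :
  (0 < B)%N -> (0 < eval m e) = b ->
  (b -> wp L B c1 m Q) -> (~~ b -> wp L B c2 m Q) -> wp L B (If e c1 c2) m Q.
Proof. by move=> B0 <- h1 h2; apply: wp_if => //; rewrite leNgt => /h2. Qed.

Lemma wp_assign (L B : nat) k e1 e2 i v m (Q : memory -> Prop) :
  (0 < B)%N -> eval m e1 = i -> eval m e2 = v ->
  (bounded B m -> `|v| < 2 ^ B)%N -> Q (update m (loc k i) v) ->
  wp L B (SetArr k e1 e2) m Q.
Proof. by move=> B0 <- <- vB q; apply: wp_set. Qed.

Arguments wp_assign {L B k e1 e2} i v {m Q}.

(* Registers: [vd], [vts] largest deficit and its slot; [vj], [vdj], [vpj] the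
   candidate resource, its reduced weight and its residual cost; [vdi] the
   reduced weight of resource [vi]; [vm] the slack; [vq] the capacity (or number
   of copies) to add or remove; [vW], [vC] common denominators. Arrays: start,
   end, capacity, residual cost and kind of each resource, deficit of each slot,
   solution, and for each round the resource selected ([aO]) if any ([aF]). *)
Notation vT := 0%N (only parsing).
Notation vN := 1%N (only parsing).
Notation vW := 2%N (only parsing).
Notation vC := 3%N (only parsing).
Notation vi := 4%N (only parsing).
Notation vt := 5%N (only parsing).
Notation vk := 6%N (only parsing).
Notation vd := 7%N (only parsing).
Notation vts := 8%N (only parsing).
Notation vj := 9%N (only parsing).
Notation vdj := 10%N (only parsing).
Notation vpj := 11%N (only parsing).
Notation vdi := 12%N (only parsing).
Notation vm := 13%N (only parsing).
Notation vq := 14%N (only parsing).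
Notation aS := 15%N (only parsing).
Notation aE := 16%N (only parsing).
Notation aW := 17%N (only parsing).
Notation aP := 18%N (only parsing).
Notation aM := 19%N (only parsing).
Notation aR := 20%N (only parsing).
Notation aX := 21%N (only parsing).
Notation aO := 22%N (only parsing).
Notation aF := 23%N (only parsing).

Declare Scope expr_scope.
Delimit Scope expr_scope with X.
Bind Scope expr_scope with expr.
Notation "x + y" := (Op OpAdd x y) : expr_scope.
Notation "x - y" := (Op OpSub x y) : expr_scope.
Notation "x * y" := (Op OpMul x y) : expr_scope.
Notation "x / y" := (Op OpDiv x y) : expr_scope.
Notation "0" := (Const 0) : expr_scope.
Notation "1" := (Const 1) : expr_scope.
Notation "x ;; y" := (Seq x y) (at level 60, right associativity).

(* Positive exactly when [s <= t <= e], because [s <= e]. *)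
Definition act_test (i t : expr) : expr :=
  ((t - Arr aS i + 1) * (Arr aE i - t + 1))%X.

Definition max_prog : program :=
  SetVar vd 0 ;; SetVar vts 0 ;;
  For vt (Var vT + 1)
    (If (Arr aR (Var vt) - Var vd)
       (SetVar vd (Arr aR (Var vt)) ;; SetVar vts (Var vt)) Skip).

Definition delta_prog : program :=
  SetVar vdi 0 ;;
  If (act_test (Var vi) (Var vts))
    (If (1 - Arr aX (Var vi))
       (If (Arr aW (Var vi) - Var vd)
          (SetVar vdi (Var vd)) (SetVar vdi (Arr aW (Var vi)))) Skip) Skip.

(* Initially the ratio [vpj / vdj] is 1 / 0, so the first resource of positive
   weight is taken. *)
Definition select_prog : program :=
  SetVar vj 0 ;; SetVar vdj 0 ;; SetVar vpj 1 ;;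
  For vi (Var vN)
    (delta_prog ;;
     If (Var vpj * Var vdi - Arr aP (Var vi) * Var vdj)
       (SetVar vj (Var vi) ;; SetVar vdj (Var vdi) ;;
        SetVar vpj (Arr aP (Var vi))) Skip).

Definition price_prog : program :=
  For vi (Var vN)
    (delta_prog ;;
     SetArr aP (Var vi)
       (Arr aP (Var vi) * Var vdj - Var vpj * Var vdi)).

Definition deficit_prog : program :=
  For vt (Var vT + 1)
    (If (act_test (Var vj) (Var vt))
       (SetArr aR (Var vt) (Arr aR (Var vt) - Var vq)) Skip).

Definition forward_prog : program :=
  max_prog ;; select_prog ;;
  If (Var vdj)
    (price_prog ;;
     If (Arr aM (Var vj))
       (SetArr aX (Var vj)
          ((Var vd + Arr aW (Var vj) - 1) / Arr aW (Var vj)))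
       (SetArr aX (Var vj) 1) ;;
     SetArr aO (Var vk) (Var vj) ;; SetArr aF (Var vk) 1 ;;
     SetVar vq (Arr aX (Var vj) * Arr aW (Var vj)) ;; deficit_prog) Skip.

Definition slack_prog : program :=
  SetVar vm (Arr aX (Var vj) * Arr aW (Var vj)) ;;
  For vt (Var vT + 1)
    (If (act_test (Var vj) (Var vt))
       (If (Var vm + Arr aR (Var vt)) (SetVar vm (0 - Arr aR (Var vt))) Skip)
       Skip).

Definition backward_prog : program :=
  SetVar vts (Var vN - 1 - Var vk) ;;
  If (Arr aF (Var vts))
    (SetVar vj (Arr aO (Var vts)) ;; slack_prog ;;
     If (Var vm)
       (SetVar vq (Var vm / Arr aW (Var vj)) ;;
        SetArr aX (Var vj) (Arr aX (Var vj) - Var vq) ;;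
        SetVar vq (0 - Var vq * Arr aW (Var vj)) ;; deficit_prog) Skip) Skip.

Definition main_prog : program :=
  For vk (Var vN) forward_prog ;; For vk (Var vN) backward_prog.

(** * Correctness of the covering program and bounds on its stored values *)

Section Verification.

Variables (n T : nat) (s e : nat -> nat) (w c : nat -> int) (M : nat -> bool).
Variables (D : nat -> int) (X : int).

Hypothesis s_gt0 : forall i, (i < n)%N -> (0 < s i)%N.
Hypothesis se : forall i, (i < n)%N -> (s i <= e i)%N.
Hypothesis eT : forall i, (i < n)%N -> (e i <= T)%N.
Hypothesis w_ge0 : forall i, (i < n)%N -> 0 <= w i.
Hypothesis w_leX : forall i, (i < n)%N -> w i <= X.
Hypothesis c_ge0 : forall i, (i < n)%N -> 0 <= c i.
Hypothesis c_leX : forall i, (i < n)%N -> c i <= X.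
Hypothesis D_ge0 : forall t, 0 <= D t.
Hypothesis D_leX : forall t, D t <= X.
Hypothesis D_0 : D 0 = 0.
Hypothesis X_ge1 : 1 <= X.

Variables L B : nat.
Hypothesis B_gt0 : (0 < B)%N.
Hypothesis nL : (n <= L)%N.
Hypothesis TL : (T < L)%N.
Hypothesis LB : (L < 2 ^ B)%N.
Hypothesis powB : X ^+ n.+1 < (2 ^ B)%N%:Z.
Hypothesis linB : 2 * n%:Z * X + 3 * X < (2 ^ B)%N%:Z.

Local Notation act := (act s e).
Local Notation deficit := (deficit n s e w D).
Local Notation delta := (delta s e w).
Local Notation wp := (wp L B).

Definition statics : seq nat := [:: vT; vN; aS; aE; aW; aM].

Definition static (m : memory) : Prop :=
  [/\ cell m vT 0 = T%:Z, cell m vN 0 = n%:Z &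
      forall i : nat, (i < n)%N ->
        [/\ cell m aS i%:Z = (s i)%:Z, cell m aE i%:Z = (e i)%:Z,
            cell m aW i%:Z = w i & cell m aM i%:Z = (M i)%:Z]].

Lemma static_frame ks m m' :
  ~~ has (mem statics) ks -> frame ks m m' -> static m -> static m'.
Proof.
move=> /hasPn dis fr [mT mN mi].
have fr' k z : k \in statics -> cell m' k z = cell m k z.
  move=> ks'; apply: fr.
    by apply: (allP (_ : all (fun k => k < 24)%N statics)).
  by apply/negP => /dis /negP; apply.
rewrite /static !fr' //; split=> // i iN; have [? ? ? ?] := mi i iN.
by rewrite !fr'.
Qed.

Lemma act_testP m i t ei et : static m -> (i < n)%N ->
  eval m ei = i%:Z -> eval m et = t%:Z ->
  (0 < eval m (act_test ei et)) = act i t.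
Proof.
move=> [_ _ mi] iN hi ht; have [S E _ _] := mi i iN.
rewrite /act_test !evalE hi ht S E /act; have := se iN.
move: (s i) (e i) => a b ab; apply/idP/andP => [h|[h1 h2]]; last first.
  by apply: mulr_gt0; lia.
by split; rewrite leqNgt; apply/negP => h'; move: h; apply/negP;
  rewrite -leNgt; nia.
Qed.

(** Slot 0 lies in no interval and has no demand. As a sentinel it makes the initial maximum 0 of
    the search an attained one, so the peak is nonnegative even if all real slots are
    overcovered. *)
Lemma deficit_0 x : deficit x 0 = 0.
Proof.
rewrite /deficit D_0 /cap big_pred0 ?subr0 // => i.
by rewrite /act; have := s_gt0 (ltn_ord i); lia.
Qed.

Definition demands (m : memory) (x : nat -> int) : Prop :=
  forall t : nat, (t <= T)%N -> cell m aR t%:Z = deficit x t.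

Definition entries (m : memory) (a : nat) (x : nat -> int) : Prop :=
  forall i : nat, (i < n)%N -> cell m a i%:Z = x i.

Lemma slots_bound ks m m' : ~~ has (mem statics) ks -> frame ks m m' ->
  static m -> eval m' (Var vT + 1) = T.+1%:Z.
Proof.
move=> dis fr /(static_frame dis fr)[mT _ _].
by rewrite !evalE mT -addn1 PoszD.
Qed.

Lemma items_bound ks m m' : ~~ has (mem statics) ks -> frame ks m m' ->
  static m -> eval m' (Var vN) = n%:Z.
Proof. by move=> dis fr /(static_frame dis fr)[]. Qed.

Lemma fits_cell m k z : bounded B m -> (`|cell m k z| < 2 ^ B)%N.
Proof. exact. Qed.

Lemma fits0 : (`|0%:Z| < 2 ^ B)%N.
Proof. by rewrite expn_gt0. Qed.

Lemma fits_small (k : nat) : (k <= L)%N -> (`|k%:Z| < 2 ^ B)%N.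
Proof. by move=> kL; rewrite absz_nat; apply: leq_ltn_trans LB. Qed.

Lemma max_progP m x (Q : memory -> Prop) :
  static m -> demands m x ->
  (forall m' t d, frame [:: vd; vts; vt] m m' -> peak n T s e w D x t d ->
     cell m' vts 0 = t%:Z -> cell m' vd 0 = d -> Q m') ->
  wp max_prog m Q.
Proof.
move=> st dem q; rewrite /max_prog.
apply: wp_seq => //; apply: (wp_assign 0 0) => // [_|]; first exact: fits0.
apply: wp_seq => //; apply: (wp_assign 0 0) => // [_|]; first exact: fits0.
set m0 := update _ _ _.
have fr0 : frame [:: vd; vts; vt] m m0 by solve_frame.
have st0 : static m0 by apply: (static_frame _ fr0 st).
pose Inv k m' := exists t d, [/\ cell m' vts 0 = t%:Z, cell m' vd 0 = d,
  (t <= T)%N, 0 <= d /\ d = deficit x t &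
  forall t', (t' < k)%N -> deficit x t' <= d].
apply: (@wp_for_frame _ _ _ _ _ T.+1 [:: vd; vts; vt] Inv) => //.
- exact: leq_ltn_trans LB.
- by move=> m' fr; apply: (slots_bound _ fr st0).
- by exists 0%N, 0; split=> //; rewrite deficit_0.
- move=> k m' kT fr [t [d [mt md tT [d0 dt] dmax]]] mk.
  have Rk : cell m' aR k%:Z = deficit x k.
    by use_frame fr; use_frame fr0; apply: dem.
  apply: wp_if => //; rewrite !evalE mk Rk md => cmp.
    apply: wp_seq => //; apply: (wp_assign 0 (deficit x k)) => //.
    - by rewrite !evalE mk Rk.
    - by rewrite -Rk; apply: fits_cell.
    apply: (wp_assign 0 k%:Z) => //.
    - by move=> _; apply: fits_small; lia.
    split; [by solve_frame | by simpl_cells | exists k, (deficit x k)].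
    simpl_cells; split=> //; first by split=> //; lia.
    by move=> t'; rewrite ltnS leq_eqVlt => /predU1P[->//|/dmax]; lia.
  apply: wp_skip; split=> //; exists t, d; split=> //.
  by move=> t'; rewrite ltnS leq_eqVlt => /predU1P[->|/dmax //]; lia.
- move=> m' fr [t [d [mt md tT [d0 dt] dmax]]]; apply: (q m' t d) => //.
  exact: frame_trans fr.
Qed.

Lemma delta_progP m i t d x (Q : memory -> Prop) :
  static m -> (i < n)%N -> cell m vi 0 = i%:Z -> cell m vts 0 = t%:Z ->
  cell m vd 0 = d -> cell m aX i%:Z = x i -> 0 <= x i ->
  (forall m', frame [:: vdi] m m' -> cell m' vdi 0 = delta x t d i -> Q m') ->
  wp delta_prog m Q.
Proof.
move=> st iN mi mt md mx xi q; rewrite /delta_prog.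
apply: wp_seq => //; apply: (wp_assign 0 0) => // [_|]; first exact: fits0.
set m0 := update _ _ _.
have fr0 : frame [:: vdi] m m0 by solve_frame.
have st0 : static m0 by apply: (static_frame _ fr0 st).
have [_ _ /(_ i iN)[_ _ wi _]] := st.
have done0 : delta x t d i = 0 -> Q m0.
  by move=> di; apply: q => //; rewrite di; simpl_cells.
apply: (@wp_if_bool _ _ (act i t)) => // [|ai|ai]; first exact: act_testP.
  2: by apply: wp_skip; apply: done0; rewrite /delta (negPf ai).
have m0i : cell m0 vi 0 = i%:Z by rewrite /m0; simpl_cells.
have m0d : cell m0 vd 0 = d by rewrite /m0; simpl_cells.
have m0w : cell m0 aW i%:Z = w i by rewrite /m0; simpl_cells.
have m0x : cell m0 aX i%:Z = x i by rewrite /m0; simpl_cells.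
apply: wp_if => //; rewrite !evalE m0i m0x => x0; last first.
  apply: wp_skip; apply: done0; rewrite /delta ai /=.
  by case: eqP => // xi0; lia.
have deltaE : delta x t d i = Num.min (w i) d.
  by rewrite /delta ai /=; case: eqP => // xi0; lia.
apply: wp_if => //; rewrite !evalE m0i m0w m0d => cmp.
- apply: (wp_assign 0 d) => // [|]; first by rewrite -m0d => b; apply: fits_cell.
  apply: q; first by solve_frame.
  by simpl_cells; rewrite deltaE min_r //; lia.
- apply: (wp_assign 0 (w i)) => // [||].
  + by rewrite !evalE m0i.
  + by rewrite -m0w => b; apply: fits_cell.
  apply: q; first by solve_frame.
  by simpl_cells; rewrite deltaE min_l //; lia.
Qed.

Definition round_regs : seq nat := [:: vj; vdj; vpj; vi; vdi].

(** The least ratio of residual cost to reduced weight is found by cross multiplication. Replacement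
    is strict and residual costs are nonnegative, so a candidate always has positive reduced
    weight. *)
Lemma select_progP m x p t d (Q : memory -> Prop) :
  static m -> entries m aX x -> entries m aP p ->
  (forall i, (i < n)%N -> 0 <= x i) -> (forall i, (i < n)%N -> 0 <= p i) ->
  0 <= d -> cell m vts 0 = t%:Z -> cell m vd 0 = d ->
  (forall m' (j : nat) dj, frame round_regs m m' ->
     cell m' vj 0 = j%:Z -> cell m' vdj 0 = dj ->
     (dj = 0 /\ forall i, (i < n)%N -> delta x t d i <= 0) \/
     [/\ (j < n)%N, 0 < dj, dj = delta x t d j, cell m' vpj 0 = p j &
         forall i, (i < n)%N -> p j * delta x t d i <= p i * dj] -> Q m') ->
  wp select_prog m Q.
Proof.
move=> st ex ep x0 p0 d0 mt md q; rewrite /select_prog.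
apply: wp_seq => //; apply: (wp_assign 0 0) => // [_|]; first exact: fits0.
apply: wp_seq => //; apply: (wp_assign 0 0) => // [_|]; first exact: fits0.
apply: wp_seq => //; apply: (wp_assign 0 1) => // [_|].
  by apply: (@fits_small 1); lia.
set m0 := update _ _ _.
have fr0 : frame round_regs m m0 by solve_frame.
have st0 : static m0 by apply: (static_frame _ fr0 st).
pose Inv k m' := exists (j : nat) dj pj,
  [/\ cell m' vj 0 = j%:Z, cell m' vdj 0 = dj, cell m' vpj 0 = pj &
  [/\ dj = 0, pj = 1 & forall i, (i < k)%N -> delta x t d i <= 0] \/
  [/\ (j < n)%N, 0 < dj, dj = delta x t d j, pj = p j &
      forall i, (i < k)%N -> p j * delta x t d i <= p i * dj]].
apply: (@wp_for_frame _ _ _ _ _ n round_regs Inv) => //.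
- exact: leq_ltn_trans LB.
- by move=> m' fr; apply: (items_bound _ fr st0).
- by exists 0%N, 0, 1; rewrite /m0; simpl_cells; split=> //; left.
- move=> k m1 kn fr [j [dj [pj [mj mdj mpj cases]]]] mk.
  have fr1 : frame round_regs m m1 by apply: frame_trans fr.
  have st1 : static m1 by apply: (static_frame _ fr1 st).
  apply: wp_seq => //; apply: (@delta_progP m1 k t d x) => //.
  - by use_frame fr1.
  - by use_frame fr1.
  - by use_frame fr1; apply: ex.
  - exact: x0.
  move=> m2 fr2 md2.
  have fr2' : frame round_regs m1 m2 by apply: frame_sub fr2.
  have fr3 : frame round_regs m m2 by apply: frame_trans fr2'.
  have m2k : cell m2 vi 0 = k%:Z by use_frame fr2.
  have m2j : cell m2 vj 0 = j%:Z by use_frame fr2.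
  have m2dj : cell m2 vdj 0 = dj by use_frame fr2.
  have m2pj : cell m2 vpj 0 = pj by use_frame fr2.
  have m2P : cell m2 aP k%:Z = p k by use_frame fr3; apply: ep.
  have dk0 := delta_ge0 s e w_ge0 x t kn d0.
  apply: wp_if => //; rewrite !evalE m2k m2dj m2pj md2 m2P => cmp; last first.
    apply: wp_skip; split=> //; exists j, dj, pj; split=> //.
    case: cases => [[dj0 pj1 low]|[jn dj0 djE pjE low]]; [left|right];
      split=> // i; rewrite ltnS leq_eqVlt => /predU1P[->|/low //].
      by move: cmp; rewrite dj0 pj1; lia.
    by move: cmp; rewrite pjE; lia.
  have dk1 : 0 < delta x t d k.
    have := p0 k kn.
    case: cases => [[dj0 pj1 low]|[jn dj0 djE pjE low]]; first by nia.
    by have := p0 j jn; rewrite -pjE; nia.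
  apply: wp_seq => //; apply: (wp_assign 0 k%:Z) => //.
  - by move=> _; apply: fits_small; lia.
  apply: wp_seq => //; apply: (wp_assign 0 (delta x t d k)) => //.
  - by move=> b; have := fits_cell vdi 0 b; simpl_cells; rewrite md2.
  apply: (wp_assign 0 (p k)) => //.
  - by rewrite !evalE; simpl_cells; rewrite m2k.
  - by move=> b; have := fits_cell aP k%:Z b; simpl_cells; rewrite m2P.
  split; [by solve_frame | by simpl_cells |].
  exists k, (delta x t d k), (p k); simpl_cells; split=> //; right; split=> //.
  move=> i; rewrite ltnS leq_eqVlt => /predU1P[->//|ik].
  have iN : (i < n)%N by apply: ltn_trans kn.
  have di0 := delta_ge0 s e w_ge0 x t iN d0; have pi0 := p0 i iN.
  case: cases => [[dj0 pj1 low]|[jn dj0 djE pjE low]].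
    have -> : delta x t d i = 0 by have := low i ik; lia.
    by rewrite mulr0 mulr_ge0 // ltW.
  (* Cross-multiplied comparisons chain through the old candidate only after multiplication by its
     reduced weight [dj], which is positive here. *)
  rewrite -(ler_pM2r dj0).
  apply: le_trans (_ : p j * delta x t d i * delta x t d k <= _).
    have : p k * dj <= p j * delta x t d k by move: cmp; rewrite pjE; lia.
    by move=> /(ler_wpM2r di0); lra.
  by have := ler_wpM2r dk0 (low i ik); lra.
- move=> m1 fr [j [dj [pj [mj mdj mpj cases]]]].
  apply: (q m1 j dj) => //; first exact: frame_trans fr.
  by case: cases => [[? ? ?]|[? ? ? <- ?]]; [left | right].
Qed.

(** The update is in place. The residual cost of the selected resource must come from the register
    [vpj], because its entry in [aP] becomes 0 during the loop. *)
Lemma price_progP m x p t d dj pj (p' : nat -> int) (Q : memory -> Prop) :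
  static m -> entries m aX x -> entries m aP p ->
  (forall i, (i < n)%N -> 0 <= x i) ->
  cell m vts 0 = t%:Z -> cell m vd 0 = d ->
  cell m vdj 0 = dj -> cell m vpj 0 = pj ->
  (forall i, (i < n)%N -> p' i = p i * dj - pj * delta x t d i) ->
  (forall i, (i < n)%N -> `|p' i| < 2 ^ B)%N ->
  (forall m', frame [:: aP; vi; vdi] m m' -> entries m' aP p' -> Q m') ->
  wp price_prog m Q.
Proof.
move=> st ex ep x0 mt md mdj mpj p'E p'B q; rewrite /price_prog.
pose Inv (k : nat) m' := forall i : nat, (i < n)%N ->
  cell m' aP i%:Z = if (i < k)%N then p' i else p i.
apply: (@wp_for_frame _ _ _ _ _ n [:: aP; vi; vdi] Inv) => //.
- exact: leq_ltn_trans LB.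
- by move=> m' fr; apply: (items_bound _ fr st).
- by move=> k m' z inv i iN; simpl_cells; apply: inv.
- move=> k m1 kn fr inv mk.
  have st1 : static m1 by apply: (static_frame _ fr st).
  apply: wp_seq => //; apply: (@delta_progP m1 k t d x) => //.
  - by use_frame fr.
  - by use_frame fr.
  - by use_frame fr; apply: ex.
  - exact: x0.
  move=> m2 fr2 md2.
  have fr2' : frame [:: aP; vi; vdi] m1 m2 by apply: frame_sub fr2.
  have fr3 : frame [:: aP; vi; vdi] m m2 by apply: frame_trans fr2'.
  have m2k : cell m2 vi 0 = k%:Z by use_frame fr2.
  have m2dj : cell m2 vdj 0 = dj by use_frame fr3.
  have m2pj : cell m2 vpj 0 = pj by use_frame fr3.
  have m2P i : (i < n)%N -> cell m2 aP i%:Z = if (i < k)%N then p' i else p i.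
    by move=> iN; use_frame fr2; apply: inv.
  apply: (wp_assign k%:Z (p' k)) => //.
  - by rewrite !evalE m2k m2dj m2pj md2 m2P // ltnn p'E.
  - by move=> _; apply: p'B.
  split; [by solve_frame | by simpl_cells |].
  move=> i iN; rewrite cell_update // eqxx /= eqz_nat m2P //.
  case: eqVneq => [->|ki]; first by rewrite ltnSn.
  by rewrite ltnS [in RHS]leq_eqVlt [i == k]eq_sym (negPf ki).
- move=> m1 fr inv; apply: q => // i iN; by rewrite inv // iN.
Qed.

(** Shared by both passes: [v] is the capacity added in the forward pass and minus the capacity
    removed in the backward pass. *)
Lemma deficit_progP m j v (r r' : nat -> int) (Q : memory -> Prop) :
  static m -> (j < n)%N -> cell m vj 0 = j%:Z -> cell m vq 0 = v ->
  (forall t : nat, (t <= T)%N -> cell m aR t%:Z = r t) ->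
  (forall t, (t <= T)%N -> r' t = r t - (if act j t then v else 0)) ->
  (forall t, (t <= T)%N -> `|r' t| < 2 ^ B)%N ->
  (forall m', frame [:: aR; vt] m m' ->
     (forall t : nat, (t <= T)%N -> cell m' aR t%:Z = r' t) -> Q m') ->
  wp deficit_prog m Q.
Proof.
move=> st jn mj mq mr r'E r'B q; rewrite /deficit_prog.
pose Inv (k : nat) m' := forall t : nat, (t <= T)%N ->
  cell m' aR t%:Z = if (t < k)%N then r' t else r t.
apply: (@wp_for_frame _ _ _ _ _ T.+1 [:: aR; vt] Inv) => //.
- exact: leq_ltn_trans LB.
- by move=> m' fr; apply: (slots_bound _ fr st).
- by move=> k m' z inv t tT; simpl_cells; apply: inv.
- move=> k m1 kT fr inv mk.
  have st1 : static m1 by apply: (static_frame _ fr st).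
  have m1j : cell m1 vj 0 = j%:Z by use_frame fr.
  have m1q : cell m1 vq 0 = v by use_frame fr.
  have next t : t != k -> (t < k.+1)%N = (t < k)%N.
    by move=> tk; rewrite ltnS leq_eqVlt (negPf tk).
  apply: (@wp_if_bool _ _ (act j k)) => //; first exact: act_testP.
    move=> a; apply: (wp_assign k%:Z (r' k)) => //.
    - by rewrite !evalE mk m1q inv // ltnn r'E // a.
    - by move=> _; apply: r'B.
    split; [by solve_frame | by simpl_cells |].
    move=> t tT; rewrite cell_update // eqxx /= eqz_nat inv //.
    by case: eqVneq => [->|tk]; [rewrite ltnSn | rewrite next // eq_sym].
  move=> a; apply: wp_skip; split=> // t tT; rewrite inv //.
  have [->|tk] := eqVneq t k; last by rewrite next.
  by rewrite ltnn ltnSn r'E // (negPf a) subr0.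
- by move=> m1 fr inv; apply: q => // t tT; rewrite inv // ltnS tT.
Qed.

Lemma slack_progP m j x (Q : memory -> Prop) :
  static m -> (j < n)%N -> cell m vj 0 = j%:Z -> cell m aX j%:Z = x j ->
  (`|(w j * x j)%R| < 2 ^ B)%N -> demands m x ->
  (forall m' v, frame [:: vm; vt] m m' -> cell m' vm 0 = v ->
     v <= w j * x j ->
     (forall t, (t <= T)%N -> act j t -> v <= - deficit x t) ->
     v = w j * x j \/
       (exists2 t, (t <= T)%N & act j t /\ v = - deficit x t) -> Q m') ->
  wp slack_prog m Q.
Proof.
move=> st jn mj mx wxB mr q; rewrite /slack_prog.
have [_ _ /(_ j jn)[_ _ wj _]] := st.
apply: wp_seq => //; apply: (wp_assign 0 (w j * x j)) => //.
  by rewrite !evalE mj mx wj mulrC.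
set m0 := update _ _ _.
have fr0 : frame [:: vm; vt] m m0 by solve_frame.
have st0 : static m0 by apply: (static_frame _ fr0 st).
pose Inv (k : nat) m' := exists v, [/\ cell m' vm 0 = v, v <= w j * x j,
  forall t, (t < k)%N -> act j t -> v <= - deficit x t &
  v = w j * x j \/ (exists2 t, (t <= T)%N & act j t /\ v = - deficit x t)].
apply: (@wp_for_frame _ _ _ _ _ T.+1 [:: vm; vt] Inv) => //.
- exact: leq_ltn_trans LB.
- by move=> m' fr; apply: (slots_bound _ fr st0).
- by exists (w j * x j); rewrite /m0; simpl_cells; split=> //; left.
- move=> k m1 kT fr [v [mv vx low att]] mk.
  have fr1 : frame [:: vm; vt] m m1 by apply: frame_trans fr.
  have st1 : static m1 by apply: (static_frame _ fr1 st).
  have m1j : cell m1 vj 0 = j%:Z by use_frame fr1.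
  have m1r : cell m1 aR k%:Z = deficit x k by use_frame fr1; apply: mr.
  apply: (@wp_if_bool _ _ (act j k)) => //; first exact: act_testP.
    move=> a; apply: wp_if => //; rewrite !evalE mk mv m1r => cmp.
      apply: (wp_assign 0 (- deficit x k)) => //.
      - by rewrite !evalE mk m1r sub0r.
      - by rewrite -m1r abszN => b; apply: fits_cell.
      split; [by solve_frame | by simpl_cells |].
      exists (- deficit x k); simpl_cells; split=> //; first lia.
        by move=> t; rewrite ltnS leq_eqVlt => /predU1P[->//|/low h /h]; lia.
      by right; exists k.
    apply: wp_skip; split=> //; exists v; split=> // t.
    by rewrite ltnS leq_eqVlt => /predU1P[->|/low //]; lia.
  move=> a; apply: wp_skip; split=> //; exists v; split=> // t.
  by rewrite ltnS leq_eqVlt => /predU1P[->|/low //]; rewrite (negPf a).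
- move=> m1 fr [v [mv vx low att]]; apply: (q m1 v) => //.
  exact: frame_trans fr.
Qed.

Local Notation forward_inv := (forward_inv n s e w M D X).
Local Notation forward_step := (forward_step n T s e w M D).
Local Notation backward_step := (backward_step n T s e w D).
Local Notation backward_inv := (backward_inv n T s e w D).
Local Notation history := (history n T s e w c M D).
Local Notation covers := (covers n T s e w M D).
Local Notation small := (small n w X).

Lemma fits_lin v :
  - (2 * n%:Z * X + 3 * X) <= v <= 2 * n%:Z * X + 3 * X -> (`|v| < 2 ^ B)%N.
Proof.
move=> /andP[h1 h2]; rewrite -ltz_nat abszE ltr_norml.
by apply/andP; split; move: linB h1 h2; lra.
Qed.

Lemma fits_deficit x t : small x -> (`|deficit x t| < 2 ^ B)%N.
Proof.
move=> sx; apply: fits_lin.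
have /andP[h1 h2] := small_deficit s e w_ge0 D_ge0 D_leX X_ge1 t sx.
have nX : 0 <= 2 * n%:Z * X by rewrite mulr_ge0 //; lia.
by apply/andP; split; lia.
Qed.

Lemma fits_entry x i : small x -> (i < n)%N ->
  (`|x i| < 2 ^ B)%N /\ (`|(w i * x i)%R| < 2 ^ B)%N.
Proof.
move=> sx iN; have [x0 xX wx] := sx i iN.
have nX : 0 <= 2 * n%:Z * X by rewrite mulr_ge0 //; lia.
have wx0 : 0 <= w i * x i by rewrite mulr_ge0 // w_ge0.
by split; apply: fits_lin; apply/andP; split; lia.
Qed.

(** A round that selects nothing writes nothing, so its flag in [aF] is the initial 0. *)
Definition logged (m : memory) (k : nat) (o : option nat) : Prop :=
  if o is Some j then
    [/\ cell m aF k%:Z = 1, cell m aO k%:Z = j%:Z & (j < n)%N]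
  else cell m aF k%:Z = 0.

Definition forward_regs : seq nat :=
  [:: vd; vts; vt; vj; vdj; vpj; vi; vdi; vq; aP; aR; aX; aO; aF].

Lemma forward_progP m k p x (Q : memory -> Prop) :
  static m -> entries m aP p -> entries m aX x -> demands m x ->
  forward_inv k p x -> (k < n)%N -> cell m vk 0 = k%:Z ->
  cell m aF k%:Z = 0 ->
  (forall m' p' x' o, frame forward_regs m m' ->
     (forall k' : nat, k' != k -> cell m' aF k'%:Z = cell m aF k'%:Z /\
        cell m' aO k'%:Z = cell m aO k'%:Z) ->
     logged m' k o -> entries m' aP p' -> entries m' aX x' -> demands m' x' ->
     forward_step p x p' x' o -> Q m') ->
  wp forward_prog m Q.
Proof.
move=> st ep ex dem inv kn mk mF q; rewrite /forward_prog.
have [pk sx _] := inv.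
have x0 i : (i < n)%N -> 0 <= x i by move=> iN; case: (sx i iN).
have p0 i : (i < n)%N -> 0 <= p i by move=> iN; case/andP: (pk i iN).
apply: wp_seq => //; apply: (max_progP st dem) => m1 t d fr1 peak_t m1t m1d.
have st1 : static m1 by apply: (static_frame _ fr1 st).
have d0 : 0 <= d by case: peak_t.
have ex1 : entries m1 aX x by move=> i iN; use_frame fr1; apply: ex.
have ep1 : entries m1 aP p by move=> i iN; use_frame fr1; apply: ep.
apply: wp_seq => //; apply: (select_progP st1 ex1 ep1 x0 p0 d0 m1t m1d).
move=> m2 j dj fr2 m2j m2dj cases.
have F1 : frame forward_regs m m1 by apply: frame_sub fr1.
have F2 : frame forward_regs m m2.
  by apply: frame_trans F1 _; apply: frame_sub fr2.
have ex2 : entries m2 aX x by move=> i iN; use_frame fr2; apply: ex1.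
have ep2 : entries m2 aP p by move=> i iN; use_frame fr2; apply: ep1.
have dem2 : demands m2 x by move=> i iN; use_frame fr2; use_frame fr1; apply: dem.
have st2 : static m2 by apply: (static_frame _ fr2 st1).
apply: wp_if => //; rewrite eval_Var m2dj => dj0; last first.
  apply: wp_skip; apply: (q m2 p x None) => //.
  - by move=> k' _; use_frame fr2; use_frame fr1.
  - by rewrite /logged; use_frame fr2; use_frame fr1.
  - exists t, d; split=> //; split=> //.
    by case: cases => [[_ ?] //|[_ ? _ _ _]]; lia.
case: cases => [[djE _]|[jn _ djE m2pj min_j]]; first lia.
pose p' i := p i * dj - p j * delta x t d i.
pose x' i := if i == j then copies w M d j else x i.
have stp : forward_step p x p' x' (Some j).
  by exists t, d; rewrite /p' /x' djE; split=> //; split; rewrite -?djE.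
have inv' := forward_invS eT w_ge0 w_leX D_ge0 D_leX X_ge1 inv stp.
have [pk' sx' _] := inv'.
have [_ _ /(_ j jn)[_ _ wj Mj]] := st2.
apply: wp_seq => //; apply: (@price_progP m2 x p t d dj (p j) p') => //.
- by use_frame fr2.
- by use_frame fr2.
- move=> i iN; have /andP[h1 h2] := pk' i iN.
  rewrite -ltz_nat abszE ger0_norm //; apply: le_lt_trans h2 _.
  by apply: le_lt_trans powB; apply: ler_weXn2l.
move=> m3 fr3 ep3.
have F3 : frame forward_regs m m3.
  by apply: frame_trans F2 _; apply: frame_sub fr3.
have m3j : cell m3 vj 0 = j%:Z by use_frame fr3.
have m3d : cell m3 vd 0 = d by use_frame fr3; use_frame fr2.
have m3k : cell m3 vk 0 = k%:Z by use_frame F3.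
have m3w : cell m3 aW j%:Z = w j by use_frame fr3.
have m3M : cell m3 aM j%:Z = (M j)%:Z by use_frame fr3.
have [copiesB wcopiesB] := fits_entry sx' jn.
rewrite /x' eqxx in copiesB wcopiesB.
apply: wp_seq => //.
set Q' := fun _ => _.
(* Both branches of the test on the kind store the value [copies], so what follows is verified once
   for both. *)
have Q'4 : Q' (update m3 (loc aX j%:Z) (copies w M d j)).
  rewrite /Q' {Q'}.
  set m4 := update _ _ _.
  have fr4 : frame [:: aX] m3 m4 by solve_frame.
  have ex4 : entries m4 aX x'.
    move=> i iN; rewrite /m4 /x' cell_update // eqxx /= eqz_nat eq_sym.
    by case: eqP => // _; use_frame fr3; apply: ex2.
  apply: wp_seq => //; apply: (wp_assign k%:Z j%:Z) => //.
  - by rewrite eval_Var; use_frame fr4.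
  - by rewrite eval_Var; use_frame fr4.
  - by move=> _; apply: fits_small; lia.
  apply: wp_seq => //; apply: (wp_assign k%:Z 1) => //.
  - by rewrite eval_Var; simpl_cells; use_frame fr4.
  - by move=> _; apply: (@fits_small 1); lia.
  apply: wp_seq => //; apply: (wp_assign 0 (w j * copies w M d j)) => //.
  - rewrite !evalE; simpl_cells.
    have -> : cell m4 vj 0 = j%:Z by use_frame fr4.
    have -> : cell m4 aW j%:Z = w j by use_frame fr4.
    by rewrite ex4 // /x' eqxx mulrC.
  set m5 := update _ _ _.
  have fr5 : frame [:: vq; aF; aO] m4 m5 by solve_frame.
  have F5 : frame forward_regs m m5.
    apply: frame_trans F3 _; apply: frame_trans (_ : frame _ m3 m4) _.
      exact: frame_sub fr4.
    exact: frame_sub fr5.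
  apply: (@deficit_progP m5 j (w j * copies w M d j) (deficit x) (deficit x')).
  - exact: (static_frame _ F5 st).
  - by [].
  - by use_frame fr5; use_frame fr4.
  - by rewrite /m5; simpl_cells.
  - by move=> t' t'T; use_frame fr5; use_frame fr4; use_frame fr3; apply: dem2.
  - move=> t' t'T; rewrite (@deficit_set _ _ _ _ _ x x' j) //.
      have dj1 : 0 < delta x t d j by rewrite -djE.
      by have [_ xj _ _] := delta_gt0 dj1; rewrite /x' eqxx xj subr0.
    by move=> i iN /negPf ij; rewrite /x' ij.
  - by move=> t' t'T; apply: fits_deficit.
  move=> m6 fr6 dem6; apply: (q m6 p' x' (Some j)) => //.
  - by apply: frame_trans F5 _; apply: frame_sub fr6.
  - move=> k' k'k; use_frame fr6; rewrite /m5; simpl_cells.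
    rewrite !cell_update // !eqz_nat eq_sym (negPf k'k) !andbF.
    by simpl_cells; use_frame fr4; use_frame fr3; use_frame fr2; use_frame fr1.
  - by split=> //; use_frame fr6; rewrite /m5; simpl_cells.
  - by move=> i iN; use_frame fr6; use_frame fr5; use_frame fr4; apply: ep3.
  - by move=> i iN; use_frame fr6; use_frame fr5; apply: ex4.
apply: wp_if => //; rewrite !evalE m3j m3M => Mpos.
- apply: (wp_assign j%:Z (copies w M d j)) => //.
  by rewrite !evalE m3j m3d m3w /copies; case: (M j) Mpos.
- apply: (wp_assign j%:Z (copies w M d j)) => //.
  by rewrite /copies; case: (M j) Mpos.
Qed.

Lemma entries_frame ks m m' a x : (a < 24)%N -> a \notin ks ->
  frame ks m m' -> entries m a x -> entries m' a x.
Proof. by move=> a24 aks fr ea i iN; rewrite fr // ea. Qed.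

Lemma demands_frame ks m m' x : aR \notin ks ->
  frame ks m m' -> demands m x -> demands m' x.
Proof. by move=> aks fr dm t tT; rewrite fr // dm. Qed.

Lemma logged_frame ks m m' k o : aF \notin ks -> aO \notin ks ->
  frame ks m m' -> logged m k o -> logged m' k o.
Proof. by move=> aks oks fr; rewrite /logged; case: o => [j|]; rewrite !fr. Qed.

Lemma forward_loopP m (Q : memory -> Prop) :
  static m -> entries m aP c -> entries m aX (fun=> 0) ->
  demands m (fun=> 0) -> entries m aF (fun=> 0) ->
  (forall m' Hp Hx Ho, frame (vk :: forward_regs) m m' ->
     history n Hp Hx Ho -> entries m' aX (Hx n) -> demands m' (Hx n) ->
     (forall k, (k < n)%N -> logged m' k (Ho k)) -> Q m') ->
  wp (For vk (Var vN) forward_prog) m Q.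
Proof.
move=> st ep ex dem eF q.
pose Inv k m' := exists Hp Hx Ho,
  [/\ history k Hp Hx Ho, entries m' aP (Hp k), entries m' aX (Hx k),
      demands m' (Hx k) &
      (forall k', (k' < k)%N -> logged m' k' (Ho k')) /\
      (forall k' : nat, (k <= k')%N -> (k' < n)%N -> cell m' aF k'%:Z = 0)].
apply: (@wp_for_frame _ _ _ _ _ n (vk :: forward_regs) Inv) => //.
- exact: leq_ltn_trans LB.
- by move=> m' fr; apply: (items_bound _ fr st).
- move=> k m' z [Hp [Hx [Ho [h1 h2 h3 h4 [h5 h6]]]]]; exists Hp, Hx, Ho.
  have fr : frame [:: vk] m' (update m' (loc vk 0) z) by solve_frame.
  split=> //; [exact: entries_frame fr h2 | exact: entries_frame fr h3
    | exact: demands_frame fr h4 | split].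
    by move=> k' k'k; apply: logged_frame fr (h5 k' k'k).
  by move=> k' kk' k'n; use_frame fr; apply: h6.
- exists (fun=> c), (fun _ _ => 0), (fun=> None).
  by split=> //; split=> // k' _; apply: eF.
- move=> k m1 kn fr1 [Hp [Hx [Ho [hist ep1 ex1 dem1 [log1 eF1]]]]] mk.
  have st1 : static m1 by apply: (static_frame _ fr1 st).
  have inv := history_inv eT w_ge0 w_leX c_ge0 c_leX D_ge0 D_leX X_ge1
    hist (leqnn k).
  apply: (@forward_progP m1 k (Hp k) (Hx k)) => //; first exact: eF1.
  move=> m2 p' x' o fr2 keep log2 ep2 ex2 dem2 stp.
  split; [exact: frame_sub fr2 | by use_frame fr2 |].
  (* The recorded rounds are kept and the new state is appended as entry [k.+1]. *)
  pose ext A (H : nat -> A) a := fun k' => if (k' <= k)%N then H k' else a.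
  have extE A (H : nat -> A) a k' : (k' <= k)%N -> ext A H a k' = H k'.
    by rewrite /ext => ->.
  have extS A (H : nat -> A) a : ext A H a k.+1 = a by rewrite /ext ltnn.
  pose Ho' k' := if (k' < k)%N then Ho k' else o.
  exists (ext _ Hp p'), (ext _ Hx x'), Ho'; rewrite !extS.
  split=> //; last split.
  + case: hist => hp0 hx0 hs; split; rewrite ?extE // => k'.
    rewrite ltnS leq_eqVlt => /predU1P[->|k'k].
      by rewrite !extS !extE // /Ho' ltnn.
    by rewrite !extE ?(ltnW k'k) // /Ho' k'k; apply: hs.
  + move=> k'; rewrite ltnS leq_eqVlt /Ho' => /predU1P[->|k'k].
      by rewrite ltnn.
    rewrite k'k; have := log1 k' k'k; rewrite /logged.
    have ne : k' != k by rewrite ltn_eqF.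
    by have [-> ->] := keep k' ne.
  + move=> k' kk' k'n; have ne : k' != k by rewrite gtn_eqF.
    have [-> _] := keep k' ne.
    by apply: eF1 => //; apply: ltnW.
- move=> m1 fr1 [Hp [Hx [Ho [hist ep1 ex1 dem1 [log1 eF1]]]]].
  exact: (q m1 Hp Hx Ho).
Qed.

Definition backward_regs : seq nat := [:: vts; vj; vm; vt; vq; aX; aR].

(** No coverage by [x] is assumed, so the run stays within its bounds on infeasible instances too.
    The index [l] reverses the order of the rounds. *)
Lemma backward_progP m k l o x (Q : memory -> Prop) :
  static m -> entries m aX x -> demands m x -> small x -> (k < n)%N ->
  cell m vk 0 = k%:Z -> l = (n - k.+1)%N -> logged m l o ->
  (forall m' x', frame backward_regs m m' -> entries m' aX x' ->
     demands m' x' -> small x' ->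
     (if o is Some j then backward_step x x' j else x' = x) -> Q m') ->
  wp backward_prog m Q.
Proof.
move=> st ex dem sx kn mk lE log q; rewrite /backward_prog.
have [_ mn mi] := st.
apply: wp_seq => //; apply: (wp_assign 0 l%:Z) => //.
- by rewrite !evalE mk mn lE -subzn // -addn1 PoszD; ring.
- by move=> _; apply: fits_small; lia.
set m1 := update _ _ _.
have fr1 : frame [:: vts] m m1 by solve_frame.
have m1l : cell m1 vts 0 = l%:Z by rewrite /m1; simpl_cells.
case: o log q => [j [mF mO jn]|mF] q; last first.
  apply: wp_if => //; rewrite !evalE m1l /m1; simpl_cells; rewrite mF // => _.
  apply: wp_skip; apply: (q _ x) => //; first exact: frame_sub fr1.
    exact: entries_frame fr1 ex.
  exact: demands_frame fr1 dem.
have [_ _ mw mM] := mi j jn.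
apply: wp_if => //; rewrite !evalE m1l /m1; simpl_cells; rewrite mF // => _.
rewrite -/m1; apply: wp_seq => //; apply: (wp_assign 0 j%:Z) => //.
- by rewrite !evalE m1l; use_frame fr1.
- by move=> _; apply: fits_small; lia.
set m2 := update _ _ _.
have fr2 : frame [:: vts; vj] m m2 by solve_frame.
have st2 : static m2 by apply: (static_frame _ fr2 st).
have m2j : cell m2 vj 0 = j%:Z by rewrite /m2; simpl_cells.
have [xB wxB] := fits_entry sx jn.
apply: wp_seq => //; apply: (@slack_progP m2 j x) => //.
- by use_frame fr2; apply: ex.
- by move=> t tT; use_frame fr2; apply: dem.
move=> m3 v fr3 m3v v1 v2 v3.
have st3 : static m3 by apply: (static_frame _ fr3 st2).
have F3 : frame backward_regs m m3.
  apply: frame_trans (_ : frame _ m m2) _; first exact: frame_sub fr2.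
  exact: frame_sub fr3.
pose x' i := if i == j then x j - (if 0 < v then (v %/ w j)%Z else 0) else x i.
have stp : backward_step x x' j by exists v.
have sx' := backward_step_small w_ge0 X_ge1 jn sx stp.
have ex3 : entries m3 aX x.
  by move=> i iN; use_frame fr3; use_frame fr2; apply: ex.
have dem3 : demands m3 x.
  by move=> t tT; use_frame fr3; use_frame fr2; apply: dem.
apply: wp_if => //; rewrite eval_Var m3v => v0; last first.
  apply: wp_skip; apply: (q m3 x) => //.
  exists v; split=> // i iN; case: ltrP => [|_]; first lia.
  by case: eqP => // ->; rewrite subr0.
have m3j : cell m3 vj 0 = j%:Z by use_frame fr3.
have m3w : cell m3 aW j%:Z = w j by use_frame fr3; use_frame fr2.
have [x0 xX wxX] := sx j jn.
have w0 : 0 < w j by have := w_ge0 jn; nia.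
have [q1 q2] := divz_bounds v w0.
set d := (v %/ w j)%Z in q1 q2 x' stp sx'.
have d0 : 0 <= d by rewrite divz_ge0 // ltW.
rewrite v0 in x' stp sx'.
have x'j : x' j = x j - d by rewrite /x' eqxx.
apply: wp_seq => //; apply: (wp_assign 0 d) => //.
- by rewrite !evalE m3v m3j m3w.
- rewrite /d -m3v => b; apply: leq_ltn_trans (lez_div _ _) _; exact: fits_cell b.
apply: wp_seq => //; apply: (wp_assign j%:Z (x' j)) => //.
- by rewrite !evalE; simpl_cells; rewrite m3j ex3.
- by move=> _; case: (fits_entry sx' jn).
apply: wp_seq => //; apply: (wp_assign 0 (- (w j * d))) => //.
- by rewrite !evalE; simpl_cells; rewrite m3j m3w; ring.
- move=> _; apply: fits_lin.
  have nX : 0 <= 2 * n%:Z * X by rewrite mulr_ge0 //; lia.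
  have wd : 0 <= w j * d by rewrite mulr_ge0 // ltW.
  by apply/andP; split; lia.
set m4 := update _ _ _.
have fr4 : frame [:: vq; aX] m3 m4 by solve_frame.
have F4 : frame backward_regs m m4.
  by apply: frame_trans F3 _; apply: frame_sub fr4.
apply: (@deficit_progP m4 j (- (w j * d)) (deficit x) (deficit x')).
- exact: (static_frame _ F4 st).
- by [].
- by use_frame fr4.
- by rewrite /m4; simpl_cells.
- by move=> t tT; use_frame fr4; apply: dem3.
- move=> t tT; rewrite (@deficit_set _ _ _ _ _ x x' j) //.
    by rewrite x'j; congr (_ - _); case: ifP => // _; ring.
  by move=> i iN /negPf ij; rewrite /x' ij.
- by move=> t tT; apply: fits_deficit.
move=> m5 fr5 dem5; apply: (q m5 x') => //.
- by apply: frame_trans F4 _; apply: frame_sub fr5.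
- move=> i iN; use_frame fr5; rewrite /m4; simpl_cells.
  rewrite cell_update // eqxx /= eqz_nat eq_sym.
  case: eqP => [->//|/eqP/negPf ij]; simpl_cells.
  by rewrite ex3 // /x' ij.
Qed.

(** The comparison solution [y] is quantified inside the postcondition: one run, verified
    independently of any solution, is compared with all of them. *)
Lemma main_progP m (Q : memory -> Prop) :
  static m -> entries m aP c -> entries m aX (fun=> 0) ->
  demands m (fun=> 0) -> entries m aF (fun=> 0) ->
  (forall m' x, static m' -> entries m' aX x -> small x ->
     (forall y, covers y -> covers x /\
        \sum_(i < n) c i * x i <= 4 * \sum_(i < n) c i * y i) -> Q m') ->
  wp main_prog m Q.
Proof.
move=> st ep ex dem eF q; rewrite /main_prog; apply: wp_seq => //.
apply: (forward_loopP st ep ex dem eF) => m1 Hp Hx Ho fr1 hist ex1 dem1 log1.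
have st1 : static m1 by apply: (static_frame _ fr1 st).
have [_ sxn _] := history_inv eT w_ge0 w_leX c_ge0 c_leX D_ge0 D_leX X_ge1
  hist (leqnn n).
pose Inv k m' := exists x, [/\ entries m' aX x, demands m' x, small x &
  forall y, covers y -> backward_inv Hp Hx y (n - k)%N x].
apply: (@wp_for_frame _ _ _ _ _ n (vk :: backward_regs) Inv) => //.
- exact: leq_ltn_trans LB.
- by move=> m' fr; apply: (items_bound _ fr st1).
- move=> k m' z [x [h1 h2 h3 h4]]; exists x.
  have fr : frame [:: vk] m' (update m' (loc vk 0) z) by solve_frame.
  by split=> //; [apply: entries_frame fr h1 | apply: demands_frame fr h2].
- exists (Hx n); split=> // y cy; rewrite subn0.
  exact: (backward_inv_start eT w_ge0 w_leX c_ge0 c_leX D_ge0 D_leX X_ge1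
    hist cy).
- move=> k m2 kn fr2 [x [ex2 dem2 sx inv]] mk.
  have st2 : static m2 by apply: (static_frame _ fr2 st1).
  have ln : (n - k.+1 < n)%N by lia.
  have lS : (n - k = (n - k.+1).+1)%N by lia.
  have log2 : logged m2 (n - k.+1) (Ho (n - k.+1)%N).
    by apply: logged_frame fr2 (log1 _ ln).
  apply: (backward_progP st2 ex2 dem2 sx kn mk erefl log2).
  move=> m3 x' fr3 ex3 dem3 sx' stp.
  split; [exact: frame_sub fr3 | by use_frame fr3 |].
  exists x'; split=> // y cy; have := inv y cy; rewrite lS.
  case HoE: (Ho _) stp => [j|] => [stp|->] inv'.
    exact: (backward_inv_some eT w_ge0 w_leX c_ge0 c_leX D_ge0 D_leX X_ge1
      hist cy ln HoE inv' stp).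
  exact: (backward_inv_none hist ln HoE inv').
- move=> m2 fr2 [x [ex2 dem2 sx inv]]; apply: (q m2 x) => //.
    exact: (static_frame _ fr2 st1).
  move=> y cy; have := inv y cy; rewrite subnn.
  exact: (backward_inv_end eT w_ge0 w_leX c_ge0 c_leX D_ge0 D_leX X_ge1 hist).
Qed.

End Verification.

(** * Encoding and scaling of instances *)

Definition nth_res (I : instance) (i : nat) : resource :=
  if insub i is Some o then @res I o else Resource 1 1 0 0 SType.

Lemma nth_resE (I : instance) (i : 'I_(nres I)) : nth_res I i = res i.
Proof. by rewrite /nth_res valK. Qed.

Definition field (I : instance) (i f : nat) : int :=
  nth 0 (encode_resource (nth_res I i)) f.

Definition input (I : instance) (k : nat) : int := nth 0 (encode I) k.

(** Two header cells and one cell per slot precede the records, which have seven fields each. *)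
Definition field_offset (I : instance) (i f : nat) : nat :=
  horizon I + 2 + 7 * i + f.

Lemma input_demand I t : (t < horizon I)%N ->
  input I (t + 2) = (demand I t.+1)%:Z.
Proof.
move=> tT; rewrite /input addn2 /= nth_cat size_map size_iota tT.
by rewrite (nth_map 0%N) ?size_iota // nth_iota // add1n.
Qed.

Lemma nth_flatten_const (A : Type) (x0 : A) d (ss : seq (seq A)) i f :
  all (fun s => size s == d) ss -> (i < size ss)%N -> (f < d)%N ->
  nth x0 (flatten ss) (d * i + f) = nth x0 (nth [::] ss i) f.
Proof.
move=> + + fd; elim: ss i => [|s ss IH] [|i] //= /andP[/eqP sd all_d] iss.
  by rewrite muln0 nth_cat sd fd.
by rewrite nth_cat sd mulnS -addnA ltnNge leq_addr /= addKn IH.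
Qed.

Lemma input_field I i f : (i < nres I)%N -> (f < 7)%N ->
  input I (field_offset I i f) =
  field I i f.
Proof.
move=> iN f7; rewrite /input /field_offset addnAC -!addnA addnCA add2n /=.
rewrite nth_cat size_map size_iota ltnNge leq_addr /= addKn addnC.
rewrite nth_flatten_const //; last by rewrite size_map size_enum_ord.
  rewrite (nth_map (Ordinal iN)) ?size_enum_ord //.
  by rewrite -nth_resE nth_enum_ord.
by apply/allP => s /mapP[o _ ->].
Qed.

Lemma input_sizeE I : input_size I =
  (bits (horizon I)%:Z + (bits (nres I)%:Z +
   (\sum_(t <- iota 1 (horizon I)) bits (demand I t)%:Z +
    \sum_(0 <= i < nres I) \sum_(z <- encode_resource (nth_res I i)) bits z)))%N.
Proof.
rewrite /input_size /encode !big_cons big_cat /= big_map big_flatten /= big_map.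
rewrite big_enum /= big_mkord; congr (_ + (_ + (_ + _)))%N.
by apply: eq_bigr => i _; rewrite nth_resE.
Qed.

Lemma bits_input_size I z : z \in encode I -> (bits z <= input_size I)%N.
Proof. by move=> zI; rewrite /input_size (big_rem z) //= leq_addr. Qed.

Lemma bits_gt0 z : (0 < bits z)%N.
Proof. by []. Qed.

(** Every demand and every resource takes at least one bit of the input, so loops over slots or
    resources are polynomial although the horizon itself is written in binary. *)
Lemma horizon_nres_input_size I :
  [/\ (horizon I <= input_size I)%N, (nres I <= input_size I)%N &
      (2 <= input_size I)%N].
Proof.
have hT : (horizon I <= \sum_(t <- iota 1 (horizon I)) bits (demand I t)%:Z)%N.
  rewrite -[X in (X <= _)%N](size_iota 1) -sum1_size; exact: leq_sum.
have hN : (nres I <= \sum_(0 <= i < nres I)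
    \sum_(z <- encode_resource (nth_res I i)) bits z)%N.
  rewrite -[X in (X <= _)%N]subn0 -[X in (X <= _)%N]muln1 -sum_nat_const_nat.
  by apply: leq_sum => i _; rewrite big_cons /= addn_gt0.
by rewrite input_sizeE; move: hT hN; have := bits_gt0 (horizon I)%:Z;
  have := bits_gt0 (nres I)%:Z; split; lia.
Qed.

Lemma input_bits I k : (bits (input I k) <= input_size I)%N.
Proof.
have [kI|kI] := ltnP k (size (encode I)).
  by apply: bits_input_size; rewrite mem_nth.
rewrite /input nth_default // /bits trunc_log0.
by have [_ _ h] := horizon_nres_input_size I; apply: leq_trans h.
Qed.

Lemma input_abs I k : (`|input I k| < 2 ^ input_size I)%N.
Proof.
apply: leq_trans (ltn_bits _) _.
by rewrite leq_exp2l // input_bits.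
Qed.

Lemma field_abs I i f : (i < nres I)%N -> (f < 7)%N ->
  (`|field I i f| < 2 ^ input_size I)%N.
Proof. by move=> iN f7; rewrite -input_field // input_abs. Qed.

(** The bit lengths of the factors add up, and each factor is part of the input. So the plain
    product of the denominators is a short common denominator and no gcd has to be computed; partial
    products are covered because the loading loop stores them. *)
Lemma prod_field_bound I f k : (f < 7)%N -> (k <= nres I)%N ->
  (`|(\prod_(0 <= i < k) field I i f)%R|
     <= 2 ^ input_size I)%N.
Proof.
move=> f7 kn; pose b i := bits (field I i f).
have : (`|(\prod_(0 <= i < k) field I i f)%R|
        <= 2 ^ \sum_(0 <= i < k) b i)%N.
  elim: k {kn} => [|k IH]; first by rewrite !big_nil.
  rewrite !big_nat_recr //= expnD abszM leq_mul //.
  by apply: ltnW; apply: ltn_bits.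
move=> h; apply: leq_trans h _; rewrite leq_exp2l // input_sizeE.
do 3!apply: leq_trans _ (leq_addl _ _).
apply: leq_trans (_ : \sum_(0 <= i < nres I) b i <= _)%N.
  by rewrite (big_cat_nat (leq0n k) kn) /= leq_addr.
apply: leq_sum => i _.
rewrite (big_rem (field I i f)) ?leq_addr //=.
exact: mem_nth.
Qed.

Section Scaled.

Variable I : instance.
Hypothesis wfI : wf_instance I.

Let n := nres I.
Let T := horizon I.
Let sigma := input_size I.

Definition cap_scale (k : nat) : int :=
  \prod_(0 <= i < k) denq (capacity (nth_res I i)).
Definition cost_scale (k : nat) : int :=
  \prod_(0 <= i < k) denq (cost (nth_res I i)).

Definition scaled_cap (i : nat) : int :=
  (numq (capacity (nth_res I i)) * cap_scale n
     %/ denq (capacity (nth_res I i)))%Z.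
Definition scaled_cost (i : nat) : int :=
  (numq (cost (nth_res I i)) * cost_scale n %/ denq (cost (nth_res I i)))%Z.
Definition scaled_demand (t : nat) : int :=
  if (0 < t <= T)%N then (demand I t)%:Z * cap_scale n else 0.

Definition res_start (i : nat) : nat := rstart (nth_res I i).
Definition res_end (i : nat) : nat := rend (nth_res I i).
Definition is_multi (i : nat) : bool :=
  if kind (nth_res I i) is MType then true else false.

Lemma wf_nth i : (i < n)%N -> wf_resource T (nth_res I i).
Proof. by move=> iN; rewrite (nth_resE (Ordinal iN)); apply: wfI. Qed.

Lemma cap_scale_gt0 k : 0 < cap_scale k.
Proof. by rewrite /cap_scale; apply: prodr_gt0 => i _; apply: denq_gt0. Qed.

Lemma cost_scale_gt0 k : 0 < cost_scale k.
Proof. by rewrite /cost_scale; apply: prodr_gt0 => i _; apply: denq_gt0. Qed.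

Lemma cap_scale_le k : (k <= n)%N -> (`|cap_scale k| <= 2 ^ sigma)%N.
Proof. exact: (@prod_field_bound I 3). Qed.

Lemma cost_scale_le k : (k <= n)%N -> (`|cost_scale k| <= 2 ^ sigma)%N.
Proof. exact: (@prod_field_bound I 5). Qed.

Lemma scaled_ratio (q : rat) (P : int) : (denq q %| P)%Z ->
  (numq q * P %/ denq q)%Z%:~R = q * P%:~R.
Proof.
move=> /dvdzP[a ->]; rewrite mulrA mulzK ?denq_neq0 //.
by rewrite !intrM numqE; ring.
Qed.

Lemma cap_scale_dvd i : (i < n)%N ->
  (denq (capacity (nth_res I i)) %| cap_scale n)%Z.
Proof.
move=> iN; rewrite /cap_scale big_mkord (bigD1 (Ordinal iN)) //=.
exact: dvdz_mulr.
Qed.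

Lemma cost_scale_dvd i : (i < n)%N ->
  (denq (cost (nth_res I i)) %| cost_scale n)%Z.
Proof.
move=> iN; rewrite /cost_scale big_mkord (bigD1 (Ordinal iN)) //=.
exact: dvdz_mulr.
Qed.

Lemma scaled_capE i : (i < n)%N ->
  (scaled_cap i)%:~R = capacity (nth_res I i) * (cap_scale n)%:~R :> rat.
Proof. by move=> iN; apply: scaled_ratio; apply: cap_scale_dvd. Qed.

Lemma scaled_costE i : (i < n)%N ->
  (scaled_cost i)%:~R = cost (nth_res I i) * (cost_scale n)%:~R :> rat.
Proof. by move=> iN; apply: scaled_ratio; apply: cost_scale_dvd. Qed.

(** A scaled number is at most an input number times a common denominator, each of at most [sigma]
    bits up to the boundary case. *)
Definition value_bound : int := (2 ^ (2 * sigma))%N%:Z.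

Lemma value_bound_ge1 : 1 <= value_bound.
Proof. by rewrite lez_nat expn_gt0. Qed.

Lemma mul_le_value_bound (a b : int) :
  (`|a| <= 2 ^ sigma)%N -> (`|b| <= 2 ^ sigma)%N -> a * b <= value_bound.
Proof.
move=> ha hb; apply: le_trans (ler_norm _) _; rewrite -abszE abszM lez_nat.
by rewrite mul2n -addnn expnD leq_mul.
Qed.

Lemma divz_le_value_bound (a b d : int) : 0 < d ->
  (`|a| <= 2 ^ sigma)%N -> (`|b| <= 2 ^ sigma)%N -> 0 <= a * b ->
  (a * b %/ d)%Z <= value_bound.
Proof.
move=> d0 ha hb ab0; have [q1 _] := divz_bounds (a * b) d0.
have q0 : 0 <= (a * b %/ d)%Z by rewrite divz_ge0.
have := mul_le_value_bound ha hb; nia.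
Qed.

Lemma scaled_cap_bounds i : (i < n)%N ->
  0 <= scaled_cap i /\ scaled_cap i <= value_bound.
Proof.
move=> iN; have /and5P[_ _ _ c0 _] := wf_nth iN.
have p0 : 0 <= numq (capacity (nth_res I i)) * cap_scale n.
  by rewrite mulr_ge0 ?numq_ge0 // ltW // cap_scale_gt0.
split; first by rewrite divz_ge0.
apply: divz_le_value_bound => //; last exact: cap_scale_le.
by apply: ltnW; apply: (@field_abs I i 2).
Qed.

Lemma scaled_cost_bounds i : (i < n)%N ->
  0 <= scaled_cost i /\ scaled_cost i <= value_bound.
Proof.
move=> iN; have /and5P[_ _ _ _ c0] := wf_nth iN.
have p0 : 0 <= numq (cost (nth_res I i)) * cost_scale n.
  by rewrite mulr_ge0 ?numq_ge0 // ltW // cost_scale_gt0.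
split; first by rewrite divz_ge0.
apply: divz_le_value_bound => //; last exact: cost_scale_le.
by apply: ltnW; apply: (@field_abs I i 4).
Qed.

Lemma scaled_demand_bounds t :
  0 <= scaled_demand t /\ scaled_demand t <= value_bound.
Proof.
rewrite /scaled_demand; case: ifP => [/andP[t0 tT]|_]; last first.
  by split=> //; apply: le_trans value_bound_ge1.
split; first by rewrite mulr_ge0 // ltW // cap_scale_gt0.
apply: mul_le_value_bound; last exact: cap_scale_le.
have tT' : (t.-1 < horizon I)%N by rewrite prednK.
by have := input_abs I (t.-1 + 2); rewrite input_demand // prednK // => /ltnW.
Qed.

(** The successor accounts for loops over the slots 0 to [T]. *)
Definition loop_bound : nat := sigma.+1.
(* Residual costs stay below [value_bound ^+ n.+1], hence the quadratic term. *)
Definition bit_bound : nat := 2 * sigma * sigma + 6 * sigma + 10.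

Lemma loop_bound_lt : (loop_bound < 2 ^ bit_bound)%N.
Proof.
rewrite /loop_bound; apply: leq_ltn_trans (_ : bit_bound < _)%N.
  by rewrite /bit_bound; lia.
exact: ltn_expl.
Qed.

Lemma value_bound_lt : value_bound < (2 ^ bit_bound)%N%:Z.
Proof. by rewrite ltz_nat ltn_exp2l // /bit_bound; lia. Qed.

Lemma value_bound_pow : value_bound ^+ n.+1 < (2 ^ bit_bound)%N%:Z.
Proof.
have [_ nS _] := horizon_nres_input_size I.
rewrite /value_bound -natz -natrX natz ltz_nat -expnM ltn_exp2l //.
by rewrite /bit_bound; move: nS; rewrite -/n -/sigma; nia.
Qed.

Lemma value_bound_lin :
  2 * n%:Z * value_bound + 3 * value_bound < (2 ^ bit_bound)%N%:Z.
Proof.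
have [_ nS _] := horizon_nres_input_size I.
rewrite -mulrDl /value_bound.
have -> : 2 * n%:Z + 3 = (2 * n + 3)%N%:Z by rewrite PoszD PoszM.
rewrite -PoszM ltz_nat.
apply: leq_trans (_ : 2 ^ (sigma + 3) * 2 ^ (2 * sigma) <= _)%N.
  rewrite ltn_pmul2r ?expn_gt0 // expnD.
  by have := ltn_expl sigma (isT : 1 < 2)%N; move: nS; rewrite -/n -/sigma; lia.
by rewrite -expnD leq_exp2l // /bit_bound; nia.
Qed.

Local Notation covers :=
  (covers n T res_start res_end scaled_cap is_multi scaled_demand).

Definition multiplicity (S : multiset I) (i : nat) : int :=
  if insub i is Some o then (S o)%:Z else 0.

Lemma multiplicityE (S : multiset I) (i : 'I_(nres I)) :
  multiplicity S i = (S i)%:Z.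
Proof. by rewrite /multiplicity valK. Qed.

Lemma cap_multiplicity (S : multiset I) (x : nat -> int) t :
  (forall i : 'I_(nres I), x i = (S i)%:Z) ->
  (cap n res_start res_end scaled_cap x t)%:~R =
  capacity_at S t * (cap_scale n)%:~R :> rat.
Proof.
move=> xS; rewrite /cap /capacity_at rmorph_sum /= mulr_suml.
apply: eq_big => [i|i _]; first by rewrite -nth_resE.
by rewrite intrM scaled_capE // xS -nth_resE -mulr_natr -pmulrn mulrAC.
Qed.

Lemma cost_multiplicity (S : multiset I) (x : nat -> int) :
  (forall i : 'I_(nres I), x i = (S i)%:Z) ->
  (\sum_(i < n) scaled_cost i * x i)%:~R =
  total_cost S * (cost_scale n)%:~R :> rat.
Proof.
move=> xS; rewrite /total_cost rmorph_sum /= mulr_suml.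
apply: eq_bigr => i _.
by rewrite intrM scaled_costE // xS -nth_resE -mulr_natr -pmulrn mulrAC.
Qed.

(** Capacities and demands share one positive factor, so coverage of each real slot is unchanged by
    scaling. The additional slot 0 has scaled demand 0 and is covered trivially. *)
Lemma covers_feasible (S : multiset I) (x : nat -> int) :
  (forall i : 'I_(nres I), x i = (S i)%:Z) -> covers x <-> feasible S.
Proof.
move=> xS; have W0 : 0 < (cap_scale n)%:~R :> rat.
  by rewrite ltr0z cap_scale_gt0.
have slotE t : (0 < t <= T)%N ->
    (deficit n res_start res_end scaled_cap scaled_demand x t <= 0) =
    ((demand I t)%:R <= capacity_at S t).
  move=> tT; rewrite /deficit subr_le0 -(ler_int rat) (cap_multiplicity _ xS).
  by rewrite /scaled_demand tT intrM ler_pM2r.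
split=> [[x0 x1 xc]|[v f]].
- split=> [i|t tT]; last by rewrite -slotE //; apply: xc; case/andP: tT.
  move=> ki; have := x1 i (ltn_ord i); rewrite /is_multi nth_resE ki xS.
  by move/(_ isT).
- split=> [i iN|i iN|t tT].
  + by rewrite (xS (Ordinal iN)).
  + rewrite /is_multi (nth_resE (Ordinal iN)) (xS (Ordinal iN)) => Mi.
    rewrite lez_nat; apply: v; move: Mi.
    by case: (kind _).
  + have [->|t0] := posnP t; last by rewrite slotE ?t0 //; apply: f; rewrite t0.
    rewrite /deficit /scaled_demand /= sub0r oppr_le0; apply: sumr_ge0 => i _.
    by rewrite xS mulr_ge0 //; case: (scaled_cap_bounds (ltn_ord i)).
Qed.

End Scaled.

(** * Loading the input and writing the output *)

Lemma eval_Read m e : eval m (Read e) = m (eval m e).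
Proof. by []. Qed.

Notation "2" := (Const 2) : expr_scope.

Definition field_expr (f : int) : expr :=
  Read (Var vT + 2 + Const 7 * Var vi + Const f)%X.

Definition load_prog : program :=
  SetVar vT (Read 0) ;; SetVar vN (Read 1) ;; SetVar vW 1 ;; SetVar vC 1 ;;
  For vi (Var vN)
    (SetVar vW (Var vW * field_expr 3) ;; SetVar vC (Var vC * field_expr 5)) ;;
  For vi (Var vN)
    (SetArr aS (Var vi) (field_expr 0) ;; SetArr aE (Var vi) (field_expr 1) ;;
     SetArr aW (Var vi) (field_expr 2 * Var vW / field_expr 3) ;;
     SetArr aP (Var vi) (field_expr 4 * Var vC / field_expr 5) ;;
     SetArr aM (Var vi) (field_expr 6)) ;;
  For vt (Var vT)
    (SetArr aR (Var vt + 1) (Read (Var vt + 2) * Var vW)).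

Definition output_prog : program :=
  For vi (Var vN) (Store (Var vi) (Arr aX (Var vi))).

Definition smfc_prog : program := load_prog ;; main_prog ;; output_prog.

Section Loading.

Variable I : instance.
Hypothesis wfI : wf_instance I.

Let n := nres I.
Let T := horizon I.
Let L := loop_bound I.
Let B := bit_bound I.

Local Notation s := (res_start I).
Local Notation e := (res_end I).
Local Notation w := (scaled_cap I).
Local Notation c := (scaled_cost I).
Local Notation M := (is_multi I).
Local Notation D := (scaled_demand I).
Local Notation wp := (wp L B).

(** Carried as an invariant of its own during loading, because a frame does not protect the input
    cells in the residue classes of the arrays it lists. *)
Definition holds_input (m : memory) : Prop := forall a : nat, m a%:Z = input I a.

Lemma holds_input_update m k (i : nat) v : (k < 24)%N ->
  holds_input m -> holds_input (update m (loc k i%:Z) v).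
Proof. by move=> k24 h a; rewrite update_loc_input. Qed.

Lemma B_gt0 : (0 < B)%N.
Proof. by rewrite /B /bit_bound addnS. Qed.

Lemma nL : (n <= L)%N.
Proof.
by have [_ h _] := horizon_nres_input_size I; apply: leq_trans h (leqnSn _).
Qed.

Lemma TL : (T < L)%N.
Proof. by have [h _ _] := horizon_nres_input_size I; rewrite ltnS. Qed.

Lemma LB : (L < 2 ^ B)%N.
Proof. exact: loop_bound_lt. Qed.

Lemma fits_input (a : nat) : (`|input I a| < 2 ^ B)%N.
Proof.
apply: leq_trans (input_abs I a) _; rewrite leq_exp2l // /B /bit_bound.
lia.
Qed.

Lemma fits_field i f : (i < n)%N -> (f < 7)%N -> (`|field I i f| < 2 ^ B)%N.
Proof. by move=> iN f7; rewrite -input_field //; apply: fits_input. Qed.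

Lemma fits_scale (v : int) :
  (`|v| <= 2 ^ input_size I)%N -> (`|v| < 2 ^ B)%N.
Proof.
by move=> h; apply: leq_ltn_trans h _; rewrite ltn_exp2l // /B /bit_bound; lia.
Qed.

Lemma fits_value (v : int) :
  0 <= v /\ v <= value_bound I -> (`|v| < 2 ^ B)%N.
Proof.
case=> v0 vX; rewrite -ltz_nat abszE ger0_norm //.
exact: le_lt_trans vX (value_bound_lt I).
Qed.

Lemma eval_field m i f : holds_input m -> cell m vT 0 = T%:Z ->
  cell m vi 0 = i%:Z -> (i < n)%N -> (f < 7)%N ->
  eval m (field_expr f%:Z) = field I i f.
Proof.
move=> hI mT mi iN f7; rewrite -input_field // -hI /field_expr eval_Read.
by rewrite !evalE mT mi /field_offset -/T; congr (m _); lia.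
Qed.

Lemma load_progP m (Q : memory -> Prop) :
  holds_input m -> (forall k (i : nat), (k < 24)%N -> cell m k i%:Z = 0) ->
  (forall m', static n T s e w M m' -> entries n m' aP c ->
     entries n m' aX (fun=> 0) -> entries n m' aF (fun=> 0) ->
     demands n T s e w D m' (fun=> 0) -> Q m') ->
  wp load_prog m Q.
Proof.
move=> hI0 mz q; rewrite /load_prog.
have B0 := B_gt0; have nL := nL; have TL := TL; have LB := LB.
have one_fits : (`|1%:Z| < 2 ^ B)%N by apply: leq_trans LB; rewrite ltnS; lia.
apply: wp_seq => //; apply: (wp_assign 0 T%:Z) => //.
- exact: (hI0 0%N).
- by move=> _; rewrite absz_nat; apply: ltn_trans LB.
set m1 := update _ _ _.
have hI1 : holds_input m1 by apply: (@holds_input_update _ _ 0%N).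
apply: wp_seq => //; apply: (wp_assign 0 n%:Z) => //.
- exact: (hI1 1%N).
- by move=> _; rewrite absz_nat; apply: leq_ltn_trans LB.
apply: wp_seq => //; apply: (wp_assign 0 1) => //.
apply: wp_seq => //; apply: (wp_assign 0 1) => //.
set m2 := update _ _ _.
have hI2 : holds_input m2.
  by do 3!apply: (@holds_input_update _ _ 0%N) => //.
have fr2 : frame [:: vT; vN; vW; vC] m m2 by solve_frame.
have m2T : cell m2 vT 0 = T%:Z by rewrite /m2 /m1; simpl_cells.
have m2N : cell m2 vN 0 = n%:Z by rewrite /m2 /m1; simpl_cells.
pose Inv1 k m' := [/\ holds_input m', cell m' vW 0 = cap_scale I k &
  cell m' vC 0 = cost_scale I k].
apply: wp_seq => //.
apply: (@wp_for_frame _ _ _ _ _ n [:: vi; vW; vC] Inv1) => //.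
- exact: leq_ltn_trans LB.
- by move=> m' fr; rewrite eval_Var; use_frame fr.
- by split=> //; rewrite /m2 /cap_scale /cost_scale big_nil; simpl_cells.
- move=> k m3 kn fr3 [hI3 m3W m3C] m3i.
  have m3T : cell m3 vT 0 = T%:Z by use_frame fr3.
  apply: wp_seq => //; apply: (wp_assign 0 (cap_scale I k.+1)) => //.
  + rewrite !evalE (eval_field hI3 m3T m3i kn (isT : 3 < 7)%N) m3W.
    by rewrite /cap_scale big_nat_recr.
  + by move=> _; apply: fits_scale; apply: cap_scale_le.
  set m4 := update _ _ _.
  have hI4 : holds_input m4 by apply: (@holds_input_update _ _ 0%N).
  apply: (wp_assign 0 (cost_scale I k.+1)) => //.
  + rewrite !evalE (eval_field hI4 _ _ kn (isT : 5 < 7)%N) /m4; simpl_cells => //.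
    by rewrite m3C /cost_scale big_nat_recr.
  + by move=> _; apply: fits_scale; apply: cost_scale_le.
  split; [by solve_frame | by simpl_cells | split].
  + exact: (@holds_input_update _ _ 0%N).
  + by rewrite /m4; simpl_cells.
  + by simpl_cells.
move=> m3 fr3 [hI3 m3W m3C].
have m3T : cell m3 vT 0 = T%:Z by use_frame fr3.
have m3N : cell m3 vN 0 = n%:Z by use_frame fr3.
pose Inv2 (k : nat) m' := holds_input m' /\ forall i : nat, (i < k)%N ->
  [/\ cell m' aS i%:Z = (s i)%:Z, cell m' aE i%:Z = (e i)%:Z,
      cell m' aW i%:Z = w i, cell m' aM i%:Z = (M i)%:Z &
      cell m' aP i%:Z = c i].
apply: wp_seq => //.
apply: (@wp_for_frame _ _ _ _ _ n [:: vi; aS; aE; aW; aP; aM] Inv2) => //.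
- exact: leq_ltn_trans LB.
- by move=> m' fr; rewrite eval_Var; use_frame fr.
- move=> k m' z [h1 h2]; split; first exact: (@holds_input_update _ _ 0%N).
  by move=> i ik; simpl_cells; apply: h2.
- move=> k m4 kn fr4 [hI4 m4a] m4i.
  have m4T : cell m4 vT 0 = T%:Z by use_frame fr4.
  have m4W : cell m4 vW 0 = cap_scale I n by use_frame fr4.
  have m4C : cell m4 vC 0 = cost_scale I n by use_frame fr4.
  apply: wp_seq => //; apply: (wp_assign k%:Z (s k)%:Z) => //.
  + exact: (eval_field hI4 m4T m4i kn (isT : 0 < 7)%N).
  + by move=> _; apply: (@fits_field k 0).
  set m5 := update _ _ _.
  have hI5 : holds_input m5 by apply: holds_input_update.
  have m5T : cell m5 vT 0 = T%:Z by rewrite /m5; simpl_cells.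
  have m5i : cell m5 vi 0 = k%:Z by rewrite /m5; simpl_cells.
  apply: wp_seq => //; apply: (wp_assign k%:Z (e k)%:Z) => //.
  + exact: (eval_field hI5 m5T m5i kn (isT : 1 < 7)%N).
  + by move=> _; apply: (@fits_field k 1).
  set m6 := update _ _ _.
  have hI6 : holds_input m6 by apply: holds_input_update.
  have m6T : cell m6 vT 0 = T%:Z by rewrite /m6; simpl_cells.
  have m6i : cell m6 vi 0 = k%:Z by rewrite /m6; simpl_cells.
  apply: wp_seq => //; apply: (wp_assign k%:Z (w k)) => //.
  + rewrite !evalE (eval_field hI6 m6T m6i kn (isT : 2 < 7)%N).
    rewrite (eval_field hI6 m6T m6i kn (isT : 3 < 7)%N) /m6 /m5; simpl_cells.
    by rewrite m4W.
  + by move=> _; apply: fits_value; apply: scaled_cap_bounds.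
  set m7 := update _ _ _.
  have hI7 : holds_input m7 by apply: holds_input_update.
  have m7T : cell m7 vT 0 = T%:Z by rewrite /m7; simpl_cells.
  have m7i : cell m7 vi 0 = k%:Z by rewrite /m7; simpl_cells.
  apply: wp_seq => //; apply: (wp_assign k%:Z (c k)) => //.
  + rewrite !evalE (eval_field hI7 m7T m7i kn (isT : 4 < 7)%N).
    rewrite (eval_field hI7 m7T m7i kn (isT : 5 < 7)%N) /m7 /m6 /m5.
    by simpl_cells; rewrite m4C.
  + by move=> _; apply: fits_value; apply: scaled_cost_bounds.
  set m8 := update _ _ _.
  have hI8 : holds_input m8 by apply: holds_input_update.
  have m8T : cell m8 vT 0 = T%:Z by rewrite /m8; simpl_cells.
  have m8i : cell m8 vi 0 = k%:Z by rewrite /m8; simpl_cells.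
  have ME : (M k)%:Z = field I k 6.
    by rewrite /is_multi /field /=; case: (kind _).
  apply: (wp_assign k%:Z (M k)%:Z) => //.
  + by rewrite ME; apply: (eval_field hI8 m8T m8i kn (isT : 6 < 7)%N).
  + by move=> _; rewrite ME; apply: fits_field.
  set m9 := update _ _ _.
  split.
  + by rewrite /m9 /m8 /m7 /m6 /m5; solve_frame.
  + by rewrite /m9; simpl_cells.
  split; first exact: holds_input_update.
  move=> i; rewrite ltnS leq_eqVlt => /predU1P[->|ik].
    by rewrite /m9 /m8 /m7 /m6 /m5; simpl_cells.
  have [h1 h2 h3 h4 h5] := m4a i ik.
  have ki : (k%:Z == i%:Z) = false by rewrite eqz_nat gtn_eqF.
  rewrite /m9 /m8 /m7 /m6 /m5; simpl_cells.
  by rewrite !cell_update // ki !andbF /=; simpl_cells.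
move=> m4 fr4 [hI4 m4a].
have m4T : cell m4 vT 0 = T%:Z by use_frame fr4.
have m4W : cell m4 vW 0 = cap_scale I n by use_frame fr4.
have D0 : D 0 = 0 by [].
(* Iteration [k] writes slot [k.+1], hence [t <= k] rather than [t < k]; slot 0 is never written and
   its initial 0 is the right value. *)
pose Inv3 k m' := holds_input m' /\ forall t : nat, (t <= T)%N ->
  cell m' aR t%:Z = if (t <= k)%N then D t else 0.
apply: (@wp_for_frame _ _ _ _ _ T [:: vt; aR] Inv3) => //.
- exact: ltnW.
- exact: ltn_trans LB.
- by move=> m' fr; rewrite eval_Var; use_frame fr.
- move=> k m' z [h1 h2]; split; first exact: (@holds_input_update _ _ 0%N).
  by move=> i ik; simpl_cells; apply: h2.
- split=> // t tT; use_frame fr4; use_frame fr3; use_frame fr2.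
  by rewrite mz // leqn0; case: eqP => [->|].
- move=> k m5 kT fr5 [hI5 m5R] m5t.
  have m5W : cell m5 vW 0 = cap_scale I n by use_frame fr5.
  have k1 : k%:Z + 1 = k.+1%:Z by rewrite -addn1.
  have k2 : k%:Z + 2%:Z = (k + 2)%N%:Z by [].
  apply: (wp_assign k.+1%:Z (D k.+1)) => //.
  + by rewrite !evalE m5t k1.
  + rewrite eval_Mul eval_Read !evalE m5W m5t k2 hI5.
    by rewrite input_demand // /scaled_demand kT.
  + by move=> _; apply: fits_value; apply: scaled_demand_bounds.
  split; [by solve_frame | by simpl_cells | split].
    exact: holds_input_update.
  move=> t tT; rewrite cell_update // eqxx /= eqz_nat m5R //.
  case: eqVneq => [<-|tk]; first by rewrite leqnn.
  by rewrite [in RHS]leq_eqVlt eq_sym (negPf tk).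
move=> m5 fr5 [_ m5R].
apply: q.
- split; [by use_frame fr5 | by use_frame fr5; use_frame fr4 |].
  by move=> i iN; use_frame fr5; have [] := m4a i iN.
- by move=> i iN; use_frame fr5; have [] := m4a i iN.
- move=> i iN; use_frame fr5; use_frame fr4; use_frame fr3; use_frame fr2.
  exact: mz.
- move=> i iN; use_frame fr5; use_frame fr4; use_frame fr3; use_frame fr2.
  exact: mz.
- move=> t tT; rewrite m5R // tT /deficit /cap big1 ?subr0 // => i _.
  by rewrite mulr0.
Qed.

(** The output overwrites input cells, which is harmless: the solution array and the registers lie
    at negative addresses. *)
Lemma output_progP m x (Q : memory -> Prop) :
  cell m vN 0 = n%:Z -> entries n m aX x ->
  (forall m', (forall i : nat, (i < n)%N -> m' i%:Z = x i) -> Q m') ->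
  wp output_prog m Q.
Proof.
move=> mN mx q; have B0 := B_gt0.
pose Inv k m' := [/\ cell m' vN 0 = n%:Z, entries n m' aX x &
  forall i : nat, (i < k)%N -> m' i%:Z = x i].
apply: (@wp_for _ _ B0 _ _ _ n Inv) => //.
- exact: nL.
- exact: leq_ltn_trans nL LB.
- by split=> // i iN; simpl_cells; apply: mx.
- by move=> k m' [].
- move=> k m1 kn b [m1N m1x m1o] m1i; apply: wp_store => // [_|_].
    rewrite eval_Arr eval_Var m1i; exact: (b _).
  rewrite eval_Arr !eval_Var m1i m1x //; split.
    by rewrite (@cell_update_output _ k _ _ 0).
  split.
  + by simpl_cells; rewrite (@cell_update_output _ k _ _ 0).
  + by move=> i iN; simpl_cells; rewrite cell_update_output // m1x.
  + move=> i; rewrite ltnS leq_eqVlt update_loc_input // => /predU1P[->|ik].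
      by rewrite /update eqxx.
    by rewrite /update eqz_nat ltn_eqF // m1o.
- by move=> m' _ [_ _ h]; apply: q.
Qed.

End Loading.

(** * Polynomial running time, existence of the optimum and the final guarantee *)

Definition time_poly : {poly nat} :=
  time_bound ('X + 1) (2%:R * 'X * 'X + 6%:R * 'X + 10%:R) smfc_prog.

(** The two polynomials are [loop_bound] and [bit_bound] with the input size as indeterminate, and
    evaluation commutes with the syntactic time bound. *)
Lemma time_polyE I :
  time_poly.[input_size I] = time_bound (loop_bound I) (bit_bound I) smfc_prog.
Proof.
rewrite horner_time_bound; congr (time_bound _ _ _).
  by rewrite !hornerE natrDE natr1E addn1.
by rewrite !(hornerD, hornerM, hornerX, hornerMn, hornerC).
Qed.

Lemma input_memory_bounded I : bounded (bit_bound I) (input_memory I).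
Proof.
move=> [k|k]; first exact: fits_input.
by rewrite /= expn_gt0.
Qed.

Lemma smfc_progP I : wf_instance I ->
  exists (m : memory) (t : nat) (x : nat -> int),
  [/\ exec smfc_prog (input_memory I) m t, (t <= time_poly.[input_size I])%N,
      forall i : 'I_(nres I), m (val i)%:Z = x i /\ 0 <= x i &
      forall S : multiset I, feasible S ->
        covers (nres I) (horizon I) (res_start I) (res_end I) (scaled_cap I)
          (is_multi I) (scaled_demand I) x /\
        \sum_(i < nres I) scaled_cost I i * x i <=
          4 * \sum_(i < nres I) scaled_cost I i * multiplicity S i].
Proof.
move=> wfI.
suff : wp (loop_bound I) (bit_bound I) smfc_prog (input_memory I)
    (fun m => exists2 x : nat -> int,
      (forall i : 'I_(nres I), m (val i)%:Z = x i /\ 0 <= x i) &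
      forall S : multiset I, feasible S ->
        covers (nres I) (horizon I) (res_start I) (res_end I) (scaled_cap I)
          (is_multi I) (scaled_demand I) x /\
        \sum_(i < nres I) scaled_cost I i * x i <=
          4 * \sum_(i < nres I) scaled_cost I i * multiplicity S i).
  move=> /(_ (@input_memory_bounded I))[m [t [ex tb _ [x xm xS]]]].
  by exists m, t, x; rewrite time_polyE.
rewrite /smfc_prog; apply: wp_seq => //.
apply: load_progP => // [k i k24|m1 st1 eP1 eX1 eF1 dem1].
  rewrite /cell /loc /input_memory; case E: (_ - _) => [a|] //.
  by move: E; lia.
apply: wp_seq => //.
have wfn i (iN : (i < nres I)%N) := wf_nth wfI iN.
apply: (main_progP _ _ _ _ _ _ _ _ _ _ _ _ _ _ _ _ _ st1 eP1 eX1 dem1 eF1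
  (X := value_bound I)).
- by move=> i /wfn/and5P[].
- by move=> i /wfn/and5P[].
- by move=> i /wfn/and5P[].
- by move=> i /(scaled_cap_bounds wfI)[].
- by move=> i /(scaled_cap_bounds wfI)[].
- by move=> i /(scaled_cost_bounds wfI)[].
- by move=> i /(scaled_cost_bounds wfI)[].
- by move=> t; case: (scaled_demand_bounds I t).
- by move=> t; case: (scaled_demand_bounds I t).
- by [].
- exact: value_bound_ge1.
- exact: B_gt0.
- exact: nL.
- exact: TL.
- exact: LB.
- exact: value_bound_pow.
- exact: value_bound_lin.
move=> m2 x [_ m2N _] ex2 sx guarantee.
apply: (output_progP m2N ex2) => m3 out.
exists x => [i|S fS].
  split; first exact: (out i (ltn_ord i)).
  by case: (sx i (ltn_ord i)).
apply: guarantee; apply/(covers_feasible wfI (S := S)) => // i.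
exact: multiplicityE.
Qed.

(** M-type copies are unlimited, so there may be infinitely many feasible multisets; but scaled
    costs are natural numbers and a descent stops. Whether a cheaper feasible solution exists is
    decided classically. *)
Lemma optimum_exists I : wf_instance I ->
  (exists S : multiset I, feasible S) -> exists v, is_optimum I v.
Proof.
move=> wfI [S0 fS0].
pose C : rat := (cost_scale I (nres I))%:~R.
have C0 : 0 < C by rewrite ltr0z cost_scale_gt0.
pose f (S : multiset I) :=
  `|(\sum_(i < nres I) scaled_cost I i * multiplicity S i)%R|%N.
have fE S : total_cost S * C = (f S)%:R.
  rewrite -(cost_multiplicity (multiplicityE S)) pmulrn /f gez0_abs //.
  apply: sumr_ge0 => i _; rewrite multiplicityE mulr_ge0 //.
  by case: (scaled_cost_bounds wfI (ltn_ord i)).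
have [N] := ubnP (f S0); elim: N S0 fS0 => // N IH S fS; rewrite ltnS => SN.
have [[S' [fS' lt]]|none] :=
  classic (exists S', feasible S' /\ (f S' < f S)%N).
  by apply: (IH S' fS'); apply: leq_trans SN.
exists (total_cost S); split; first by exists S.
move=> S' fS'; rewrite -(ler_pM2r C0) !fE ler_nat leqNgt.
by apply/negP => lt; apply: none; exists S'.
Qed.

Theorem theorem7 : exists c : program, approximation_algorithm 4 c.
Proof.
exists smfc_prog; split.
  exists time_poly => I wfI.
  by have [m [t [x [ex tb _ _]]]] := smfc_progP wfI; exists m, t.
move=> I wfI feas; have [opt is_opt] := optimum_exists wfI feas.
have [m [t [x [ex _ out guarantee]]]] := smfc_progP wfI.
pose S (i : 'I_(nres I)) := `|x i|%N.
have xS i : x (nat_of_ord i) = (S i)%:Z.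
  by have [_ xi] := out i; rewrite /S gez0_abs.
have [[S1 fS1 S1opt] _] := is_opt.
have [cov cst] := guarantee S1 fS1.
exists m, t, S, opt; split=> //.
- by move=> i; have [-> _] := out i; apply: xS.
- by apply/(covers_feasible wfI xS).
rewrite -S1opt.
have C0 : 0 < (cost_scale I (nres I))%:~R :> rat by rewrite ltr0z cost_scale_gt0.
rewrite -(ler_pM2r C0) -mulrA -(cost_multiplicity xS).
rewrite -(cost_multiplicity (multiplicityE S1)) -[4 : rat]/(4%:~R) -intrM.
by rewrite ler_int.
Qed.
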